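(* Consider the status updating system described in the context, operating under the randomized highest $k$ selective encoding scheme with parameter $\alpha\in[0,1]$, arrival rate $\lambda>0$, and codeword lengths $\ell(x_1),\dots,\ell(x_n)$. Then the long term average age at the receiver node is $$\Delta_\alpha=\frac{\mathbb{E}[L^2]+\frac{2}{q_{k,\alpha}\lambda}\mathbb{E}[L]+\frac{2}{(q_{k,\alpha}\lambda)^2}}{2\left(\mathbb{E}[L]+\frac{1}{q_{k,\alpha}\lambda}\right)}+\mathbb{E}[L],$$ where $q_{k,\alpha}=\sum_{\ell=1}^kP_X(x_\ell)+\alpha\sum_{\ell=k+1}^nP_X(x_\ell)$, $\mathbb{E}[L]=\sum_{i=1}^nP_{X_\alpha}(x_i)\ell(x_i)$ and $\mathbb{E}[L^2]=\sum_{i=1}^nP_{X_\alpha}(x_i)\ell(x_i)^2$.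
   Context: An information source generates status update packets whose arrival times at a transmitter node form a Poisson process of rate $\lambda>0$. Each packet carries an independent realization of a random variable $X$ taking values in $\{x_1,\dots,x_n\}$ with known pmf $P_X$, where $P_X(x_m)\ge P_X(x_j)$ for all $m\le j$; realizations are independent of the arrival process. Every realization $x_i$ is assigned a binary codeword of length $\ell(x_i)$. Randomized highest $k$ selective encoding with parameter $\alpha\in[0,1]$: when a packet arrives at an idle transmitter, if its realization is $x_i$ with $i\le k$ it is encoded and sent; if $i>k$ it is encoded and sent with probability $\alpha$ and discarded with probability $1-\alpha$ (independently of everything else), in which case the transmitter keeps waiting for the next arrival. Packets arriving while the transmitter is busy are discarded (blocking). Transmission is over an error-free channel at one bit per unit time, so sending $x_i$ takes $\ell(x_i)$ time units, after which the receiver obtains the update and the transmitter becomes idle. Define $q_{k,\alpha}=\sum_{\ell=1}^kP_X(x_\ell)+\alpha\sum_{\ell=k+1}^nP_X(x_\ell)$ and $P_{X_\alpha}(x_i)=P_X(x_i)/q_{k,\alpha}$ for $i\le k$, $P_{X_\alpha}(x_i)=\alpha P_X(x_i)/q_{k,\alpha}$ for $i>k$. The instantaneous age at the receiver is $\Delta(t)=t-u(t)$, where $u(t)$ is the generation (arrival) time of the most recently received update, and the long term average age is $\lim_{T\to\infty}\frac1T\int_0^T\Delta(t)\,dt$. *)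

(* Defs.v *)
From HB Require Import structures.
From mathcomp Require Import all_boot all_order all_algebra.
From mathcomp Require Import all_classical all_reals all_analysis.
Set Implicit Arguments. Unset Strict Implicit. Unset Printing Implicit Defensive.
Import Order.TTheory GRing.Theory Num.Theory.
Import numFieldNormedType.Exports.
Local Open Scope classical_set_scope.
Local Open Scope ring_scope.

Section System.
Variables (R : realType) (n k : nat) (len : 'I_n -> nat).
(* A j = (j+1)-th interarrival time; X j = realization carried by packet j
   (index i : 'I_n stands for x_{i+1}); C j = independent coin used when
   X j is not among the k most likely realizations. *)
Variables (A : nat -> R) (X : nat -> 'I_n) (C : nat -> bool).

Definition arrival (j : nat) : R := \sum_(m < j.+1) A m.

Definition selected (j : nat) : bool := ((X j < k)%N || C j).

(* time at which the transmitter becomes idle, as seen by packet j *)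
Fixpoint free_at (j : nat) : R :=
  match j with
  | 0 => 0
  | j'.+1 => if (free_at j' <= arrival j') && selected j'
             then arrival j' + (len (X j'))%:R else free_at j'
  end.

Definition sent (j : nat) : bool := (free_at j <= arrival j) && selected j.

(* generation time of the most recently received update at time t
   (0 before the first reception, i.e. initial age t) *)
Definition last_gen (t : R) : R :=
  sup [set s | s = 0 \/ exists j, [/\ sent j, arrival j + (len (X j))%:R <= t
                                      & s = arrival j]].

Definition age (t : R) : R := t - last_gen t.

Definition avg_age (T : R) : \bar R :=
  ((T^-1)%:E * \int[lebesgue_measure]_(t in `[0%R, T]%classic) (age t)%:E)%E.
End System.

Definition mutually_independent {d} {T : measurableType d} {R : realType}
  (P : probability T R) (n : nat)
  (A : nat -> T -> R) (X : nat -> T -> 'I_n) (C : nat -> T -> bool) : Prop :=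
  forall (JA JX JC : seq nat) (B : nat -> set R) (S : nat -> set 'I_n)
         (D : nat -> set bool),
  uniq JA -> uniq JX -> uniq JC -> (forall j, measurable (B j)) ->
  P (\big[setI/setT]_(j <- JA) (A j @^-1` B j)
     `&` \big[setI/setT]_(j <- JX) (X j @^-1` S j)
     `&` \big[setI/setT]_(j <- JC) (C j @^-1` D j))
  = (\prod_(j <- JA) P (A j @^-1` B j) *
     \prod_(j <- JX) P (X j @^-1` S j) *
     \prod_(j <- JC) P (C j @^-1` D j))%E.

Section Formula.
Variables (R : realType) (n k : nat) (p : 'I_n -> R) (alpha lambda : R)
  (len : 'I_n -> nat).
Definition q_ka : R :=
  \sum_(i < n | (i < k)%N) p i + alpha * \sum_(i < n | (k <= i)%N) p i.
Definition p_alpha (i : 'I_n) : R :=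
  if (i < k)%N then p i / q_ka else alpha * p i / q_ka.
Definition EL : R := \sum_(i < n) p_alpha i * (len i)%:R.
Definition EL2 : R := \sum_(i < n) p_alpha i * ((len i)%:R ^+ 2).
Definition Delta_alpha : R :=
  (EL2 + 2 / (q_ka * lambda) * EL + 2 / (q_ka * lambda) ^+ 2)
  / (2 * (EL + 1 / (q_ka * lambda))) + EL.
End Formula.

(* Main.v *)
Require Import Defs.
From HB Require Import structures.
From mathcomp Require Import all_boot all_order all_algebra.
From mathcomp Require Import all_classical all_reals all_analysis.
From mathcomp Require Import measurable_realfun.
From mathcomp Require Import ring lra zify.
Set Implicit Arguments. Unset Strict Implicit. Unset Printing Implicit Defensive.
Import Order.TTheory GRing.Theory Num.Theory.
Import numFieldNormedType.Exports.
Local Open Scope classical_set_scope.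
Local Open Scope ring_scope.

(* Sample the system at the times [epoch j] and let [age_area j] be the area below the
   age curve up to then.  With Delta the claimed average and cycle = E[L] + 1 / (q lambda)
   the mean time between receptions,
     age_area j - Delta * epoch j + cycle * age_at j
   is a martingale: by memorylessness the mean of its next increment depends on the
   residual service only through a common factor, and the coefficient cycle makes it
   independent of the current age, which leaves one equation, solved by
   Delta = cycle + E[L ^ 2] / (2 cycle).  The age has a bounded exponential moment,
   because each selected packet resets it, so the increments are bounded in L^2 and the
   strong law for orthogonal variables makes the martingale o(N) almost surely.  As
   epoch N ~ N / lambda and age_at N = o(N), the area grows like Delta * epoch N. *)

(** * Independence *)

Section IndependentSystems.
Context {d : measure_display} {T : measurableType d} {R : realType}.
Variable P : probability T R.
Implicit Types G H : set (set T).
Local Open Scope ereal_scope.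

Definition independent_systems G H :=
  forall A B, G A -> H B -> P (A `&` B) = P A * P B.

Lemma independent_systemsC G H :
  independent_systems G H -> independent_systems H G.
Proof. by move=> GH A B HA GB; rewrite setIC GH// muleC. Qed.

Lemma sub_sigma_measurable G : G `<=` measurable -> <<s G >> `<=` measurable.
Proof. by move=> Gm; apply: smallest_sub => //; exact: sigma_algebra_measurable. Qed.

Lemma sub_sigma_measurable_fun {d' : measure_display} {T' : measurableType d'}
    G (f : T -> T') : G `<=` measurable ->
  measurable_fun [set: g_sigma_algebraType G] f -> measurable_fun [set: T] f.
Proof.
move=> Gm mf _ B mB; have := mf (@measurableT _ _) B mB.
exact: (sub_sigma_measurable Gm).
Qed.

Lemma independent_systems_sigmal G H : G `<=` measurable -> H `<=` measurable ->
  setI_closed G -> G setT ->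
  independent_systems G H -> independent_systems <<s G >> H.
Proof.
move=> Gm Hm GI GT GH A B sGA HB.
have mB := Hm _ HB.
pose PB := NngNum (fine_ge0 (measure_ge0 P B)).
have PBE : PB%:num%:E = P B by rewrite /= fineK ?fin_num_measure.
suff : forall E, <<s G >> E -> mrestr P mB E = mscale PB P E.
  by move/(_ A sGA); rewrite /mscale/= PBE muleC.
apply: (g_sigma_algebra_measure_unique G Gm (fun=> setT)) => //.
- by rewrite bigcup_const.
- by move=> C GC; rewrite /= /mscale/= PBE muleC; exact: GH.
- move=> _; apply: le_lt_trans (ltry 1).
  by apply: probability_le1; exact: measurableI.
Qed.

Lemma independent_systems_sigma G H : G `<=` measurable -> H `<=` measurable ->
  setI_closed G -> setI_closed H -> G setT -> H setT ->
  independent_systems G H -> independent_systems <<s G >> <<s H >>.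
Proof.
move=> Gm Hm GI HI GT HT GH.
apply: independent_systems_sigmal => //; first exact: sub_sigma_measurable.
apply: independent_systemsC; apply: independent_systems_sigmal => //.
exact: independent_systemsC.
Qed.

End IndependentSystems.

Section IndependentMaps.
Context {d d1 d2 : measure_display} {T : measurableType d}.
Context {T1 : measurableType d1} {T2 : measurableType d2} {R : realType}.
Variables (P : probability T R) (U : T -> T1) (V : T -> T2).
Hypotheses (mU : measurable_fun setT U) (mV : measurable_fun setT V).
Hypothesis UV : forall A B, measurable A -> measurable B ->
  (P (U @^-1` A `&` V @^-1` B) = P (U @^-1` A) * P (V @^-1` B))%E.
Local Open Scope ereal_scope.

#[local] HB.instance Definition _ := isMeasurableFun.Build _ _ _ _ U mU.
#[local] HB.instance Definition _ := isMeasurableFun.Build _ _ _ _ V mV.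

Let law1 : probability T1 R := distribution P U.
Let law2 : probability T2 R := distribution P V.

Let joint w := (U w, V w).

Let mjoint : measurable_fun setT joint.
Proof. exact: measurable_fun_pair. Qed.

Let pushforward_joint E : measurable E ->
  pushforward P joint E = (law1 \x law2) E.
Proof. by move=> mE; apply/esym; exact: product_measure_unique. Qed.

Let integral_joint (f : T1 * T2 -> \bar R) :
  \int[pushforward P joint]_x f x = \int[law1 \x law2]_x f x.
Proof. by apply: eq_measure_integral => A mA _; exact: pushforward_joint. Qed.

Lemma ge0_integral_independent (f : T1 * T2 -> \bar R) :
  measurable_fun setT f -> (forall x, 0 <= f x) ->
  \int[P]_w f (U w, V w) = \int[P]_w \int[P]_w' f (U w, V w').
Proof.
move=> mf f0.
transitivity (\int[pushforward P joint]_x f x).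
  by rewrite ge0_integral_pushforward.
rewrite integral_joint fubini_tonelli1// ge0_integral_pushforward//; last 2 first.
- exact: measurable_fun_fubini_tonelli_F.
- by move=> x _; apply: integral_ge0.
apply: eq_integral => w _ /=; rewrite /fubini_F ge0_integral_pushforward//.
exact: measurable_fun_pair2.
Qed.

Lemma integral_independent (f : T1 * T2 -> \bar R) :
  measurable_fun setT f -> P.-integrable setT (fun w => f (U w, V w)) ->
  \int[P]_w f (U w, V w) = \int[P]_w \int[P]_w' f (U w, V w').
Proof.
move=> mf intf.
have intjoint : (law1 \x law2).-integrable setT f.
  apply/integrableP; split => //; rewrite -integral_joint.
  by have /integrableP[] := integrable_pushforward mjoint mf intf measurableT.
transitivity (\int[pushforward P joint]_x f x); first by rewrite integral_pushforward.
rewrite integral_joint -integral12_prod_meas1// integral_pushforward//; last 2 first.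
- exact: measurable_fubini_F intjoint.
- have /integrableP[mF] := integrable_fubini_F intjoint.
  rewrite ge0_integral_pushforward//; last exact: measurableT_comp.
  by move=> Fy; apply/integrableP; split => //; exact: measurableT_comp.
apply: eq_integral => w _ /=; rewrite /fubini_F.
have mfU : measurable_fun setT (fun v => f (U w, v)) by exact: measurable_fun_pair2.
rewrite integralE [RHS]integralE !ge0_integral_pushforward//.
- by rewrite -funepos_comp -funeneg_comp.
- exact: measurable_funeneg.
- exact: measurable_funepos.
Qed.

End IndependentMaps.

Section IndependentSystemsIntegral.
Context {d : measure_display} {T : measurableType d} {R : realType}.
Variables (P : probability T R) (G H : set (set T)).
Hypotheses (Gm : G `<=` measurable) (Hm : H `<=` measurable).
Hypotheses (GI : setI_closed G) (HI : setI_closed H) (GT : G setT) (HT : H setT).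
Hypothesis GH : independent_systems P G H.
Local Open Scope ereal_scope.

Local Notation TG := (g_sigma_algebraType G).
Local Notation TH := (g_sigma_algebraType H).

Let measurable_idG : measurable_fun setT (id : T -> TG).
Proof. by move=> _ B mB; rewrite setTI; exact: (sub_sigma_measurable Gm). Qed.

Let measurable_idH : measurable_fun setT (id : T -> TH).
Proof. by move=> _ B mB; rewrite setTI; exact: (sub_sigma_measurable Hm). Qed.

Let independent_id (B : set TG) (E : set TH) : measurable B -> measurable E ->
  P ((id : T -> TG) @^-1` B `&` (id : T -> TH) @^-1` E) =
  P ((id : T -> TG) @^-1` B) * P ((id : T -> TH) @^-1` E).
Proof. exact: (independent_systems_sigma Gm Hm GI HI GT HT GH). Qed.

Variable g : T -> T -> R.
Hypothesis mg : measurable_fun [set: TG * TH] (fun x => g x.1 x.2).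

Let mgE : measurable_fun [set: TG * TH] (fun x => (g x.1 x.2)%:E).
Proof. exact/measurable_EFinP. Qed.

Lemma measurable_diagonal : measurable_fun [set: T] (fun w => g w w).
Proof. exact: measurableT_comp mg (measurable_fun_pair measurable_idG measurable_idH). Qed.

Lemma ge0_integral_independent_systems : (forall w w', (0 <= g w w')%R) ->
  \int[P]_w (g w w)%:E = \int[P]_w \int[P]_w' (g w w')%:E.
Proof.
move=> g0.
apply: (ge0_integral_independent measurable_idG measurable_idH independent_id mgE).
by move=> x; rewrite lee_fin.
Qed.

Lemma integral_independent_systems : P.-integrable setT (fun w => (g w w)%:E) ->
  \int[P]_w (g w w)%:E = \int[P]_w \int[P]_w' (g w w')%:E.
Proof. exact: (integral_independent measurable_idG measurable_idH independent_id mgE). Qed.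

End IndependentSystemsIntegral.

(** * The strong law of large numbers *)

Section SummableIntegrals.
Context {d : measure_display} {T : measurableType d} {R : realType}.
Variable P : probability T R.

Lemma integral_probability_cst (c : R) : (\int[P]__ c%:E = c%:E)%E.
Proof.
rewrite integral_cst//; transitivity (c%:E * 1)%E; last exact: mule1.
by congr (_ * _)%E; exact: probability_setT.
Qed.

Lemma ae_cvg0_summable_integral (f : nat -> T -> R) :
  (forall n, measurable_fun setT (f n)) -> (forall n w, 0 <= f n w) ->
  (\sum_(n <oo) \int[P]_w (f n w)%:E < +oo)%E ->
  {ae P, forall w, f n w @[n --> \oo] --> 0}.
Proof.
move=> mf f0 sf.
have mfE n : measurable_fun setT (fun w => (f n w)%:E) by exact/measurable_EFinP.
have fE0 n w : (0 <= (f n w)%:E)%E by rewrite lee_fin.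
have isf : P.-integrable setT (fun w => \sum_(n <oo) (f n w)%:E)%E.
  apply/integrableP; split; first exact: ge0_emeasurable_sum.
  under eq_integral do rewrite gee0_abs ?nneseries_ge0//.
  by rewrite integral_nneseries.
have := integrable_ae measurableT isf; apply: filterS => w /(_ I) fw.
apply: cvg_series_cvg_0; apply: nondecreasing_is_cvgn.
  by apply: nondecreasing_series => n _ _; exact: f0.
exists (fine (\sum_(n <oo) (f n w)%:E)%E) => _ [n _ <-].
by rewrite -lee_fin fineK// seriesEnat/= -sumEFin; exact: nneseries_lim_ge.
Qed.

(* Telescoping: [1 / n.+1 ^ 2 <= 2 / n.+1 - 2 / n.+2]. *)
Lemma nneseries_lty_inv_sqr (u : nat -> \bar R) (c : R) :
  (forall n, 0 <= u n)%E -> (forall n, u n <= (c / n.+1%:R ^+ 2)%:E)%E ->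
  (\sum_(n <oo) u n < +oo)%E.
Proof.
move=> u0 uc.
have c0 : 0 <= c by have := le_trans (u0 0%N) (uc 0%N); rewrite lee_fin expr1n divr1.
suff partial_le n : (\sum_(0 <= k < n) u k <= (c * (2 - 2 / n.+1%:R))%:E)%E.
  apply: (@le_lt_trans _ _ (c * 2)%:E); last exact: ltry.
  apply: lime_le; first exact: is_cvg_nneseries.
  apply: nearW => n; apply: le_trans (partial_le n) _.
  by rewrite lee_fin ler_wpM2l// gerBl divr_ge0.
elim: n => [|n IHn]; first by rewrite big_nil lee_fin divr1 subrr mulr0.
rewrite big_nat_recr//=; apply: le_trans (leeD IHn (uc n)) _.
rewrite -EFinD lee_fin -mulrDr ler_wpM2l// -[n.+2%:R]natr1.
have x1 : 1 <= n.+1%:R :> R by rewrite ler1n.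
move: (n.+1%:R : R) x1 => x x1.
rewrite -subr_ge0.
have -> : 2 - 2 / (x + 1) - (2 - 2 / x + (x ^+ 2)^-1)
    = (x - 1) / (x ^+ 2 * (x + 1)) by field; apply/andP; split; lra.
by rewrite divr_ge0 ?mulr_ge0 ?sqr_ge0//; lra.
Qed.

Lemma ae_cvg0_div_index (f : nat -> T -> R) (K : R) :
  (forall n, measurable_fun setT (f n)) ->
  (forall n, \int[P]_w (f n w ^+ 2)%:E <= K%:E)%E ->
  {ae P, forall w, f n w / n.+1%:R @[n --> \oo] --> 0}.
Proof.
move=> mf fK.
have : {ae P, forall w, (f n w / n.+1%:R) ^+ 2 @[n --> \oo] --> 0}.
  apply: ae_cvg0_summable_integral.
  - by move=> n; apply: measurable_funX; exact: measurable_funM.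
  - by move=> n w; exact: sqr_ge0.
  apply: (nneseries_lty_inv_sqr (c := K)) => n.
    by apply: integral_ge0 => w _; rewrite lee_fin sqr_ge0.
  under eq_integral do rewrite expr_div_n mulrC EFinM.
  rewrite ge0_integralZl_EFin//.
  - by rewrite mulrC EFinM lee_wpmul2l// lee_fin invr_ge0 sqr_ge0.
  - by move=> w _; rewrite lee_fin sqr_ge0.
  - by apply/measurable_EFinP; exact: measurable_funX.
apply: filterS => w sqr_cvg; apply/norm_cvg0P.
have := continuous_cvg _ (@sqrt_continuous R 0) sqr_cvg.
by rewrite sqrtr0 /comp; under eq_fun do rewrite sqrtr_sqr; exact.
Qed.

Lemma integrable_sqr_of_le (f : T -> R) (K : R) : measurable_fun setT f ->
  (\int[P]_w (f w ^+ 2)%:E <= K%:E)%E -> P.-integrable setT (fun w => (f w ^+ 2)%:E).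
Proof.
move=> mf fK; apply/integrableP; split.
  by apply/measurable_EFinP; exact: measurable_funX.
under eq_integral do rewrite gee0_abs ?lee_fin ?sqr_ge0//.
exact: le_lt_trans fK (ltry _).
Qed.

Lemma integrableM_of_sqr (f g : T -> R) :
  measurable_fun setT f -> measurable_fun setT g ->
  P.-integrable setT (fun w => (f w ^+ 2)%:E) ->
  P.-integrable setT (fun w => (g w ^+ 2)%:E) ->
  P.-integrable setT (fun w => (f w * g w)%:E).
Proof.
move=> mf mg f2 g2; apply: le_integrable (integrableD measurableT f2 g2) => //.
  by apply/measurable_EFinP; exact: measurable_funM.
move=> w _ /=; rewrite lee_fin [leRHS]ger0_norm ?addr_ge0 ?sqr_ge0//.
rewrite ler_norml; apply/andP; split; nra.
Qed.

End SummableIntegrals.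

Lemma nat_between_squares (N : nat) : (0 < N)%N ->
  exists m, (m.+1 ^ 2 <= N <= m.+1 ^ 2 + 2 * m.+1)%N.
Proof.
elim: N => // -[_ _|N IH _]; first by exists 0%N.
have [m /andP[m1 m2]] := IH isT.
have [m3|m3] := ltnP N.+1 (m.+1 ^ 2 + 2 * m.+1); first by exists m; rewrite m3 leqW.
exists m.+1; move: m2 m3; rewrite !expnSr !expn0; nia.
Qed.

Section SquareBlocks.
Context {R : realType}.
Implicit Type x : nat -> R.

(* Dominates, up to a factor 2, the square of every partial sum of index
   between [m.+1 ^ 2] and [m.+2 ^ 2]. *)
Definition block_energy x m : R := (\sum_(0 <= j < m.+1 ^ 2) x j) ^+ 2 +
  \sum_(0 <= r < (2 * m.+1).+1) (\sum_(m.+1 ^ 2 <= j < m.+1 ^ 2 + r) x j) ^+ 2.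

Lemma block_energy_ge0 x m : 0 <= block_energy x m.
Proof. by rewrite addr_ge0 ?sqr_ge0// sumr_ge0// => r _; rewrite sqr_ge0. Qed.

Lemma sqr_sum_le_block_energy x m N :
  (m.+1 ^ 2 <= N <= m.+1 ^ 2 + 2 * m.+1)%N ->
  (\sum_(0 <= j < N) x j) ^+ 2 <= 2 * block_energy x m.
Proof.
move=> /andP[mN Nm].
rewrite (big_cat_nat (n := m.+1 ^ 2))//= /block_energy.
rewrite [X in _ * (_ + X)](bigD1_seq (N - m.+1 ^ 2)%N) ?iota_uniq//=; last first.
  by rewrite mem_index_iota ltnS leq_subLR.
rewrite subnKC//; set a := \sum_(0 <= _ < _) _; set b := \sum_(_ ^ 2 <= _ < _) _.
have : 0 <= \sum_(0 <= r < (2 * m.+1).+1 | r != (N - m.+1 ^ 2)%N)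
    (\sum_(m.+1 ^ 2 <= j < m.+1 ^ 2 + r) x j) ^+ 2.
  by apply: sumr_ge0 => r _; exact: sqr_ge0.
by have := sqr_ge0 (a - b); rewrite sqrrB sqrrD; lra.
Qed.

Lemma cvg_mean0_block_energy x :
  block_energy x m / m.+1%:R ^+ 4 @[m --> \oo] --> 0 ->
  (\sum_(0 <= j < N) x j) / N%:R @[N --> \oo] --> 0.
Proof.
move=> energy0; apply/cvgrPdist_lt => e e0.
have e2 : 0 < e ^+ 2 / 2 by rewrite divr_gt0// exprn_gt0.
have /cvgrPdist_lt/(_ _ e2) [M _ small] := energy0.
exists (M.+1 ^ 2)%N => //= N /= MN; rewrite sub0r normrN.
have N0 : (0 < N)%N by exact: leq_trans (expn_gt0 M.+1 2) MN.
have [m mN] := nat_between_squares N0; have /andP[m2N Nm2] := mN.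
have Mm : (M <= m)%N by move: Nm2 MN; rewrite !expnSr !expn0; nia.
have := small _ Mm; rewrite /= sub0r normrN => /(le_lt_trans (ler_norm _)).
rewrite ltr_pdivrMr ?exprn_gt0// => small_m.
rewrite normrM normfV ltr_pdivrMr ?normr_gt0 ?pnatr_eq0 -?lt0n// -ltr_sqr ?nnegrE//; last first.
  by rewrite mulr_ge0// ltW.
rewrite exprMn !real_normK ?num_real//.
apply: le_lt_trans (sqr_sum_le_block_energy x mN) _.
have mN4 : m.+1%:R ^+ 4 <= N%:R ^+ 2 :> R.
  by rewrite (exprM _ 2 2) lerXn2r ?nnegrE ?exprn_ge0// -natrX ler_nat.
apply: lt_le_trans (_ : e ^+ 2 * m.+1%:R ^+ 4 <= _); first by lra.
by rewrite ler_wpM2l ?sqr_ge0.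
Qed.

End SquareBlocks.

Section OrthogonalStrongLaw.
Context {d : measure_display} {T : measurableType d} {R : realType}.
Variables (P : probability T R) (xi : nat -> T -> R) (K : R).
Hypothesis mxi : forall j, measurable_fun setT (xi j).
Hypothesis xiK : forall j, (\int[P]_w (xi j w ^+ 2)%:E <= K%:E)%E.
Hypothesis xi_orth : forall i j, (i < j)%N ->
  (\int[P]_w (xi i w * xi j w)%:E = 0)%E.

Let int_sqr j : P.-integrable setT (fun w => (xi j w ^+ 2)%:E).
Proof. exact: integrable_sqr_of_le (mxi j) (xiK j). Qed.

Let S a n w := \sum_(a <= j < a + n) xi j w.

Let measurable_sqr_S a n : measurable_fun setT (fun w => S a n w ^+ 2).
Proof. by apply: measurable_funX; exact: measurable_sum. Qed.

Let integral_sum_next a n :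
  P.-integrable setT (fun w => (S a n w * xi (a + n)%N w)%:E) /\
  (\int[P]_w (S a n w * xi (a + n)%N w)%:E = 0)%E.
Proof.
have int_mul i j : P.-integrable setT (fun w => (xi i w * xi j w)%:E).
  exact: integrableM_of_sqr.
have -> : (fun w => (S a n w * xi (a + n)%N w)%:E) =
    (fun w => \sum_(a <= j < a + n) (xi j w * xi (a + n)%N w)%:E)%E.
  by apply/funext => w; rewrite /S mulr_suml sumEFin.
split; first exact: integrable_sum.
by rewrite integral_sum// big_nat big1// => j /andP[_ jn]; exact: xi_orth.
Qed.

Lemma integral_sqr_sum_orthogonal a n :
  P.-integrable setT (fun w => ((\sum_(a <= j < a + n) xi j w) ^+ 2)%:E) /\
  (\int[P]_w ((\sum_(a <= j < a + n) xi j w) ^+ 2)%:E <= (K * n%:R)%:E)%E.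
Proof.
elim: n => [|n [IHi IHn]].
  under eq_fun do rewrite addn0 big_geq// expr0n.
  by rewrite integral0 mulr0; split => //; exact: integrable0.
have [int_cross cross0] := integral_sum_next a n.
have expand w : ((\sum_(a <= j < a + n.+1) xi j w) ^+ 2)%:E =
    ((S a n w ^+ 2)%:E + 2%:E * (S a n w * xi (a + n)%N w)%:E
       + (xi (a + n)%N w ^+ 2)%:E)%E.
  rewrite addnS big_nat_recr ?leq_addr// -EFinM -!EFinD; congr EFin.
  by rewrite /S /=; ring.
have int_cross2 := integrableZl measurableT 2 int_cross.
under eq_fun do rewrite expand.
split; first by apply: integrableD => //; exact: integrableD.
rewrite integralD//; last exact: integrableD.
rewrite integralD// integralZl// cross0 mule0 adde0.
by rewrite -natr1 mulrDr mulr1 EFinD; exact: leeD.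
Qed.

Let energy m w := block_energy (xi^~ w) m.

Let energyE m w : energy m w = S 0 (m.+1 ^ 2) w ^+ 2 +
  \sum_(0 <= r < (2 * m.+1).+1) S (m.+1 ^ 2) r w ^+ 2.
Proof. by rewrite /energy /block_energy /S add0n. Qed.

Let integral_energy m : (\int[P]_w (energy m w)%:E <= (10 * K * m.+1%:R ^+ 2)%:E)%E.
Proof.
under eq_integral do rewrite energyE EFinD -sumEFin.
have sqr0 a n w : (0 <= (S a n w ^+ 2)%:E)%E by rewrite lee_fin sqr_ge0.
have msqr a n : measurable_fun setT (fun w => (S a n w ^+ 2)%:E).
  exact/measurable_EFinP.
rewrite ge0_integralD//; last 2 first.
- by move=> w _; apply: sume_ge0.
- exact: emeasurable_sum.
rewrite ge0_integral_sum//.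
have x1 : 1 <= m.+1%:R :> R by rewrite ler1n.
have K0 : 0 <= K.
  rewrite -lee_fin; apply: le_trans (xiK 0%N).
  by apply: integral_ge0 => w _; rewrite lee_fin sqr_ge0.
apply: (@le_trans _ _ ((K * (m.+1 ^ 2)%:R)%:E +
    \sum_(0 <= r < (2 * m.+1).+1) (K * (3 * m.+1%:R))%:E)%E); last first.
  rewrite natrX sumEFin -EFinD lee_fin sumr_const_nat subn0.
  rewrite -[X in _ + X <= _]mulr_natr -[((2 * m.+1).+1)%:R]natr1 natrM.
  move: (m.+1%:R : R) x1 => x x1.
  have : 0 <= K * (x * (x - 1)).
    by rewrite !mulr_ge0 ?subr_ge0//; exact: le_trans x1.
  by lra.
apply: leeD; first exact: (integral_sqr_sum_orthogonal 0 (m.+1 ^ 2)).2.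
rewrite !big_nat; apply: lee_sum => r /andP[_ rm].
apply: le_trans (integral_sqr_sum_orthogonal (m.+1 ^ 2) r).2 _.
by rewrite lee_fin ler_wpM2l// -natrM ler_nat; lia.
Qed.

Lemma strong_law_orthogonal :
  {ae P, forall w, (\sum_(0 <= j < N) xi j w) / N%:R @[N --> \oo] --> 0}.
Proof.
have mE m : measurable_fun setT (energy m).
  rewrite (funext (energyE m)).
  by apply: measurable_funD => //; exact: measurable_sum.
suff : {ae P, forall w, energy m w / m.+1%:R ^+ 4 @[m --> \oo] --> 0}.
  by apply: filterS => w; exact: cvg_mean0_block_energy.
have index4_ge0 m : 0 <= (m.+1%:R ^+ 4)^-1 :> R by rewrite invr_ge0 exprn_ge0.
apply: ae_cvg0_summable_integral.
- by move=> m; exact: measurable_funM.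
- by move=> m w; rewrite mulr_ge0// block_energy_ge0.
apply: (nneseries_lty_inv_sqr (c := 10 * K)) => m.
  by apply: integral_ge0 => w _; rewrite lee_fin mulr_ge0// block_energy_ge0.
under eq_integral do rewrite mulrC EFinM.
rewrite ge0_integralZl_EFin//; last 2 first.
- by move=> w _; rewrite lee_fin block_energy_ge0.
- exact/measurable_EFinP.
apply: le_trans (lee_wpmul2l _ (integral_energy m)) _; first by rewrite lee_fin.
rewrite -EFinM lee_fin le_eqVlt; apply/orP; left; apply/eqP.
by field; rewrite nat1r pnatr_eq0.
Qed.

End OrthogonalStrongLaw.

(** * The exponential law *)

Section Derivatives.
Context {R : realType}.
Implicit Types (f g df : R -> R) (x k : R).

Lemma is_derive_mul f g x (a b : R) :
  is_derive x 1 f a -> is_derive x 1 g b ->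
  is_derive x 1 (fun t => f t * g t) (f x * b + g x * a).
Proof. by move=> df dg; exact: is_deriveM. Qed.

Lemma is_derive_expR_scale k x :
  is_derive x 1 (fun t => expR (k * t)) (k * expR (k * x)).
Proof.
have d1 : is_derive x 1 (fun t : R => k * t) k.
  by apply: is_derive_eq; rewrite /GRing.scale/= mulr1.
by rewrite mulrC; exact: is_derive1_comp (is_derive_expR _) d1.
Qed.

Lemma is_derive_shift f (l c x : R) : is_derive (x - c) 1 f l ->
  is_derive x 1 (fun t => f (t - c)) l.
Proof.
move=> dfx; rewrite -[l]mulr1.
have d1 : is_derive x 1 (fun t : R => t - c) 1.
  by have := is_deriveB (is_derive_id x 1) (is_derive_cst c x 1); rewrite subr0.
exact: (@is_derive1_comp _ f (fun t => t - c) _ _ _ dfx d1).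
Qed.

Lemma is_derive_continuous f df :
  (forall x, is_derive x 1 f (df x)) -> continuous f.
Proof.
move=> fd x; apply/differentiable_continuous/derivable1_diffP.
by have [] := fd x.
Qed.

Lemma exprn_le_expR (n : nat) x : 0 <= x -> x ^+ n.+1 <= n.+1`!%:R * expR x.
Proof.
move=> x0; rewrite -ler_pdivrMl ?ltr0n ?fact_gt0// mulrC.
by apply: le_trans (expR_ge1Dxn n x0); rewrite lerDr.
Qed.

Lemma cvg0_exprn_expR (n : nat) k : 0 < k ->
  y ^+ n * expR (- k * y) @[y --> +oo] --> (0 : R).
Proof.
move=> k0; set c := n.+1`!%:R / k ^+ n.+1.
have : c * y^-1 @[y --> +oo] --> (0 : R).
  rewrite -(mulr0 c); apply: cvgM; first exact: cvg_cst.
  by apply/gtr0_cvgV0; [exact: nbhs_pinfty_gt|exact: cvg_id].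
apply: squeeze_cvgr (cvg_cst 0); near=> y.
have y0 : 0 < y by near: y; exact: nbhs_pinfty_gt.
rewrite mulr_ge0 ?exprn_ge0 ?expR_ge0 ?(ltW y0)//= mulNr expRN.
rewrite ler_pdivrMr ?expR_gt0// mulrAC ler_pdivlMr// -exprSr /c mulrAC.
rewrite ler_pdivlMr ?exprn_gt0// -exprMn mulrC; apply: exprn_le_expR.
by rewrite mulr_ge0// ltW.
Unshelve. all: by end_near. Qed.

End Derivatives.

Section QuadraticExponential.
Context {R : realType} (theta : R).
Hypothesis theta0 : 0 < theta.

Definition quad_expR_ratio : R := 2 * (1 + 24 / theta ^+ 4).

Lemma sqr_quad_le_expR (y : R) : 0 <= y ->
  (1 + y ^+ 2) ^+ 2 <= quad_expR_ratio * expR (theta * y).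
Proof.
move=> y0; have ty0 : 0 <= theta * y by rewrite mulr_ge0// ltW.
have y4 : y ^+ 4 <= 24 / theta ^+ 4 * expR (theta * y).
  rewrite mulrAC ler_pdivlMr ?exprn_gt0// -exprMn mulrC.
  by have := exprn_le_expR 3 ty0; rewrite (_ : 4`! = 24)%N.
have e1 : 1 <= expR (theta * y) by rewrite -expR0 ler_expR.
have := sqr_ge0 (1 - y ^+ 2); rewrite /quad_expR_ratio => amgm.
have -> : (1 + y ^+ 2) ^+ 2 = 2 * (1 + y ^+ 4) - (1 - y ^+ 2) ^+ 2 by ring.
rewrite -mulrA mulrDl mul1r; lra.
Qed.

End QuadraticExponential.

Section ExponentialProb.
Context {R : realType} (rate : R).
Hypothesis rate0 : 0 < rate.
Notation mu := (@lebesgue_measure R).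

(* Solving [F' = rate (F - h)] turns the integral of [h] against the exponential
   density into a boundary value of [F]. *)
Lemma integral_exponential_pdf_tail (h F : R -> R) (s : R) : 0 <= s ->
  (forall a, s <= a -> 0 <= h a) -> continuous h ->
  (forall a : R, is_derive a 1 F (rate * (F a - h a))) ->
  F a * expR (- rate * a) @[a --> +oo] --> 0 ->
  (\int[mu]_(a in `[s, +oo[) (h a * exponential_pdf rate a)%:E =
   (F s * expR (- rate * s))%:E)%E.
Proof.
move=> s0 h0 ch dF Fy; pose density a := rate * expR (- rate * a).
have cdensity : continuous density.
  by apply: is_derive_continuous => x; exact: is_derive_mul.
have dG (x : R) : is_derive x 1 (fun a => - (F a * expR (- rate * a))) (h x * density x).
  have -> : h x * density x = - (F x * (- rate * expR (- rate * x)) +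
      expR (- rate * x) * (rate * (F x - h x))) by rewrite /density; ring.
  exact: is_deriveN (is_derive_mul (dF x) (is_derive_expR_scale _ _)).
transitivity (\int[mu]_(a in `[s, +oo[) (h a * density a)%:E)%E.
  apply: eq_integral => a; rewrite inE/= in_itv/= andbT => sa.
  by rewrite exponential_pdfE// (le_trans s0).
rewrite (@ge0_continuous_FTC2y _ _ (fun a => - (F a * expR (- rate * a))) _ 0).
- by rewrite -EFinB sub0r opprK.
- by move=> x /h0 hx; rewrite mulr_ge0// mulr_ge0 ?expR_ge0// ltW.
- by apply: continuous_subspaceT => x; apply: cvgM; [exact: ch|exact: cdensity].
- by rewrite -oppr0; exact: cvgN.
- by move=> x _; have [] := dG x.
- by apply: cvg_at_right_filter; exact: (is_derive_continuous dG).
- by move=> x _; rewrite derive1E; have [_ ->] := dG x.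
Qed.

Lemma exponential_prob_itvoy (s : R) : 0 <= s ->
  exponential_prob rate `]s, +oo[ = (expR (- rate * s))%:E.
Proof.
move=> s0; rewrite /exponential_prob integral_itv_obnd_cbnd; last first.
  by apply/measurable_EFinP/measurable_funTS; exact: measurable_exponential_pdf.
have d1 (a : R) : is_derive a 1 (cst 1 : R -> R) (rate * (cst 1 a - cst 1 a)).
  by rewrite subrr mulr0; exact: is_derive_cst.
have := @integral_exponential_pdf_tail (cst 1) (cst 1) s s0.
rewrite mul1r => <- //; first by apply: eq_integral => a _; rewrite mul1r.
- by move=> a; exact: cvg_cst.
- exact: (cvg0_exprn_expR 0 rate0).
Qed.

Lemma exponential_prob_itvoy_lt0 (s : R) : s < 0 ->
  exponential_prob rate `]s, +oo[ = 1%E.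
Proof.
move=> s0; rewrite /exponential_prob -[RHS](integral_exponential_pdf rate0).
rewrite integral_mkcond; apply: eq_integral => a _; rewrite patchE mem_setE in_itv/= andbT.
by case: ltP => // sa; rewrite lt0_exponential_pdf// (le_lt_trans sa).
Qed.

Lemma ge0_integral_exponential_prob (g : R -> \bar R) :
  measurable_fun setT g -> (forall a, 0 <= g a)%E ->
  (\int[exponential_prob rate]_a g a =
   \int[mu]_a (g a * (exponential_pdf rate a)%:E))%E.
Proof.
move=> mg g0.
have mpdf : measurable_fun setT (EFin \o exponential_pdf rate).
  by apply/measurable_EFinP; exact: measurable_exponential_pdf.
have pdf0 a : (0 <= (exponential_pdf rate a)%:E)%E.
  by rewrite lee_fin exponential_pdf_ge0// ltW.
have prob_mu : exponential_prob rate `<< mu.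
  apply/null_content_dominatesP => E mE E0.
  by apply: null_set_integral => //; exact: measurable_funTS.
rewrite -[LHS](Radon_Nikodym_SigmaFinite.change_of_variables prob_mu)//.
apply: ae_eq_integral => //; [|exact: emeasurable_funM|].
  apply: emeasurable_funM => //.
  exact: measurable_int (Radon_Nikodym_SigmaFinite.f_integrable prob_mu).
apply: ae_eqe_mul2l; apply: integral_ae_eq => //.
  exact: Radon_Nikodym_SigmaFinite.f_integrable.
by move=> E _ mE; rewrite -(Radon_Nikodym_SigmaFinite.f_integral prob_mu).
Qed.

End ExponentialProb.

Lemma eq_probability_rays {R : realType} (mu nu : probability (measurableTypeR R) R) :
  (forall x : R, mu `]x, +oo[%classic = nu `]x, +oo[%classic) ->
  forall E, measurable E -> mu E = nu E.
Proof.
move=> mu_nu; apply: (@measure_unique _ R (measurableTypeR R) (@RGenOInfty.G R)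
  (fun n => `](- n%:R : R), +oo[%classic)).
- exact: RGenOInfty.measurableE.
- move=> _ _ [x ->] [y ->]; exists (Num.max x y); apply/seteqP; split => z /=.
    by rewrite !in_itv/= !andbT gt_max => -[-> ->].
  by rewrite !in_itv/= !andbT gt_max => /andP.
- by move=> n; exists (- n%:R).
- rewrite -subTset => x _; exists (Num.truncn (- x : R)).+1 => //=.
  by rewrite in_itv/= andbT ltrNl truncnS_gt.
- by move=> _ [x ->]; exact: mu_nu.
- by move=> n; apply: le_lt_trans (ltry 1); exact: probability_le1.
Qed.

Section ExponentialVariable.
Context {d : measure_display} {T : measurableType d} {R : realType}.
Variables (P : probability T R) (A : T -> R) (rate : R).
Hypotheses (rate0 : 0 < rate) (mA : measurable_fun setT A) (A0 : forall w, 0 <= A w).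
Hypothesis A_cdf : forall s, 0 <= s ->
  P [set w | A w <= s] = (1 - expR (- rate * s))%:E.
Notation mu := (@lebesgue_measure R).

Let A' : T -> measurableTypeR R := A.
Let mA' : measurable_fun setT A'. Proof. exact: mA. Qed.
#[local] HB.instance Definition _ := isMeasurableFun.Build _ _ _ _ A' mA'.

Let distribution_exponential E : measurable E ->
  distribution P A' E = exponential_prob rate E.
Proof.
move=> mE; apply: (eq_probability_rays (nu := exponential_prob rate)) => //= s.
rewrite /distribution /pushforward.
have -> : A' @^-1` `]s, +oo[ = ~` [set w | A w <= s].
  by apply/seteqP; split => w /=; rewrite in_itv/= andbT ltNge => /negP.
have [s0|s0] := leP 0 s; last first.
  rewrite exponential_prob_itvoy_lt0// (_ : ~` _ = setT) ?probability_setT//.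
  by rewrite -subTset => w _ /=; apply/negP; rewrite -ltNge (lt_le_trans s0).
rewrite exponential_prob_itvoy// probability_setC; last first.
  by rewrite -[X in measurable X]setTI; exact: measurable_fun_le.
by rewrite A_cdf// -EFinB subKr.
Qed.

Lemma ge0_integral_exponential (g : R -> \bar R) :
  measurable_fun setT g -> (forall a, 0 <= g a)%E ->
  (\int[P]_w g (A w) = \int[mu]_a (g a * (exponential_pdf rate a)%:E))%E.
Proof.
move=> mg g0; rewrite -ge0_integral_exponential_prob//.
transitivity (\int[distribution P A']_a g a)%E.
  by rewrite ge0_integral_pushforward.
by apply: eq_measure_integral => E mE _; exact: distribution_exponential.
Qed.

(* The excess of [A] over a level that it reaches is again exponential. *)
Lemma ge0_integral_exceedance (h F : R -> R) (r : R) : 0 <= r ->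
  (forall y, 0 <= y -> 0 <= h y) -> continuous h ->
  (forall y : R, is_derive y 1 F (rate * (F y - h y))) ->
  F y * expR (- rate * y) @[y --> +oo] --> 0 ->
  (\int[P]_w (if r <= A w then h (A w - r) else 0)%:E =
   (F 0 * expR (- rate * r))%:E)%E.
Proof.
move=> r0 h0 ch dF Fy.
have mh : measurable_fun setT h by exact: continuous_measurable_fun.
pose g a := (if r <= a then h (a - r) else 0)%:E.
rewrite (ge0_integral_exponential (g := g)); last 2 first.
- apply/measurable_EFinP; apply: measurable_fun_ifT => //.
  + exact: measurable_fun_ler.
  + by apply: measurableT_comp => //; exact: measurable_funB.
- by move=> a; rewrite /g; case: ifPn => [ra|//]; rewrite lee_fin h0// subr_ge0.
transitivity (\int[mu]_(a in `[r, +oo[) (h (a - r) * exponential_pdf rate a)%:E)%E.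
  rewrite [RHS]integral_mkcond; apply: eq_integral => a _; rewrite /g.
  rewrite patchE mem_setE in_itv/= andbT.
  by case: ifPn => _; rewrite ?mul0e.
transitivity (F (r - r) * expR (- rate * r))%:E; last by rewrite subrr.
apply: (integral_exponential_pdf_tail rate0 (h := fun a => h (a - r))
  (F := fun a => F (a - r))) => //.
- by move=> a ra; rewrite h0// subr_ge0.
- by move=> a; apply: continuous_comp; [apply: cvgB; [exact: cvg_id|exact: cvg_cst]|exact: ch].
- by move=> a; apply: is_derive_shift; exact: dF.
have -> : (fun a => F (a - r) * expR (- rate * a)) =
    (fun a => F (a - r) * expR (- rate * (a - r)) * expR (- rate * r)).
  by apply/funext => a; rewrite -mulrA -expRD; congr (_ * expR _); ring.
rewrite -(mul0r (expR (- rate * r))); apply: cvgM; last exact: cvg_cst.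
have shift_oo : a - r @[a --> +oo] --> +oo by exact: cvg_addrr.
exact: (cvg_comp _ (fun y => F y * expR (- rate * y)) shift_oo Fy).
Qed.

(* Solves [F' = rate (F - y ^+ n)]; its value at 0 is the [n]-th moment. *)
Fixpoint moment_antiderivative (n : nat) (y : R) : R :=
  if n is m.+1 then y ^+ n + n%:R / rate * moment_antiderivative m y else 1.

Lemma is_derive_moment_antiderivative n (y : R) : is_derive y 1
  (moment_antiderivative n) (rate * (moment_antiderivative n y - y ^+ n)).
Proof.
elim: n => [|n IHn]; first by rewrite subrr mulr0; exact: is_derive_cst.
have dX : is_derive y 1 (fun y => y ^+ n.+1) (n.+1%:R * y ^+ n).
  have := is_deriveX n.+1 (is_derive_id y (1 : R)).
  by rewrite exprfctE /GRing.scale/= mulr1.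
have dM := is_derive_mul (is_derive_cst (n.+1%:R / rate) y 1) IHn.
apply: is_derive_eq (is_deriveD dX dM) _.
by rewrite /cst/=; field; rewrite gt_eqF.
Qed.

Lemma cvg0_moment_antiderivative n :
  moment_antiderivative n y * expR (- rate * y) @[y --> +oo] --> 0.
Proof.
elim: n => [|n IHn]; first exact: (cvg0_exprn_expR 0 rate0).
have -> : (fun y => moment_antiderivative n.+1 y * expR (- rate * y)) =
    (fun y => y ^+ n.+1 * expR (- rate * y) +
       n.+1%:R / rate * (moment_antiderivative n y * expR (- rate * y))).
  by apply/funext => y; rewrite [in LHS]/= mulrDl mulrA.
rewrite -[X in _ --> X]addr0 -[X in _ --> _ + X](mulr0 (n.+1%:R / rate)).
by apply: cvgD; [exact: cvg0_exprn_expR|apply: cvgM; [exact: cvg_cst|exact: IHn]].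
Qed.

Lemma moment_antiderivative0 n : moment_antiderivative n 0 = n`!%:R / rate ^+ n.
Proof.
elim: n => [|n IHn] /=; first by rewrite expr0 divr1.
rewrite IHn expr0n add0r factS natrM exprS.
by field; rewrite expf_neq0 ?gt_eqF.
Qed.

Lemma integral_exceedance_moment n (r : R) : 0 <= r ->
  (\int[P]_w (if r <= A w then (A w - r) ^+ n else 0)%:E =
   (n`!%:R / rate ^+ n * expR (- rate * r))%:E)%E.
Proof.
move=> r0; rewrite -(moment_antiderivative0 n).
apply: (ge0_integral_exceedance r0 _ _ (is_derive_moment_antiderivative n)).
- by move=> y; exact: exprn_ge0.
- exact: exprn_continuous.
- exact: cvg0_moment_antiderivative.
Qed.

Lemma integrable_exceedance_moment n (r : R) : 0 <= r ->
  P.-integrable setT (fun w => (if r <= A w then (A w - r) ^+ n else 0)%:E).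
Proof.
move=> r0; apply/integrableP; split.
  apply/measurable_EFinP; apply: measurable_fun_ifT => //.
  - exact: measurable_fun_ler.
  - by apply: measurable_funX; exact: measurable_funB.
under eq_integral.
  move=> w _; rewrite gee0_abs; last first.
    by rewrite lee_fin; case: ifPn => // rA; rewrite exprn_ge0// subr_ge0.
  over.
by rewrite integral_exceedance_moment// ltry.
Qed.

Lemma integral_exceedance_quadratic (h : R -> R) (c0 c1 c2 r : R) : 0 <= r ->
  (forall y, h y = c0 + c1 * y + c2 * y ^+ 2) ->
  P.-integrable setT (fun w => (if r <= A w then h (A w - r) else 0)%:E) /\
  (\int[P]_w (if r <= A w then h (A w - r) else 0)%:E =
    ((c0 + c1 / rate + c2 * 2 / rate ^+ 2) * expR (- rate * r))%:E)%E.
Proof.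
move=> r0 hE; pose e n w := (if r <= A w then (A w - r) ^+ n else 0)%:E.
have ie n : P.-integrable setT (e n) by exact: integrable_exceedance_moment.
have ice n c : P.-integrable setT (fun w => c%:E * e n w)%E by exact: integrableZl.
have Ice n c : (\int[P]_w (c%:E * e n w) =
    (c * (n`!%:R / rate ^+ n * expR (- rate * r)))%:E)%E.
  by rewrite integralZl// integral_exceedance_moment.
have -> : (fun w => (if r <= A w then h (A w - r) else 0)%:E) =
    (fun w => c0%:E * e 0%N w + c1%:E * e 1%N w + c2%:E * e 2%N w)%E.
  apply/funext => w; rewrite /e -!EFinM -!EFinD; congr EFin.
  by case: ifPn => _; rewrite ?mulr0 ?addr0// hE expr0 expr1 mulr1.
split; first by apply: integrableD => //; exact: integrableD.
rewrite integralD//; last exact: integrableD.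
rewrite integralD// !Ice -!EFinD; congr EFin.
by rewrite fact0 (_ : 1`! = 1)%N// (_ : 2`! = 2)%N// expr0 expr1 !divr1; ring.
Qed.

Lemma integral_exponential_quadratic (h : R -> R) (c0 c1 c2 : R) :
  (forall y, h y = c0 + c1 * y + c2 * y ^+ 2) ->
  P.-integrable setT (fun w => (h (A w))%:E) /\
  (\int[P]_w (h (A w))%:E = (c0 + c1 / rate + c2 * 2 / rate ^+ 2)%:E)%E.
Proof.
move=> /(integral_exceedance_quadratic (lexx 0)).
by under eq_fun do rewrite A0 subr0; rewrite mulr0 expR0 mulr1.
Qed.

Lemma integral_expR_exponential (theta : R) : theta < rate ->
  (\int[P]_w (expR (theta * A w))%:E = (rate / (rate - theta))%:E)%E.
Proof.
move=> theta_lt; set F : R -> R := fun y => rate / (rate - theta) * expR (theta * y).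
have dexp (y : R) := is_derive_expR_scale theta y.
have dF (y : R) : is_derive y 1 F (rate * (F y - expR (theta * y))).
  have -> : rate * (F y - expR (theta * y)) =
      rate / (rate - theta) * (theta * expR (theta * y)) + expR (theta * y) * 0.
    by rewrite /F; field; rewrite subr_eq0 gt_eqF.
  exact: is_derive_mul (is_derive_cst (rate / (rate - theta)) y 1) (dexp y).
have Fy : F y * expR (- rate * y) @[y --> +oo] --> 0.
  have -> : (fun y => F y * expR (- rate * y)) =
      (fun y => rate / (rate - theta) * (y ^+ 0 * expR (- (rate - theta) * y))).
    by apply/funext => y; rewrite /F expr0 mul1r -mulrA -expRD; congr (_ * expR _); ring.
  rewrite -(mulr0 (rate / (rate - theta))); apply: cvgM; first exact: cvg_cst.
  by apply: cvg0_exprn_expR; rewrite subr_gt0.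
have := ge0_integral_exceedance (lexx 0) (fun y _ => expR_ge0 (theta * y))
  (is_derive_continuous dexp) dF Fy.
rewrite /F !mulr0 expR0 !mulr1 => <-.
by apply: eq_integral => w _; rewrite A0 subr0.
Qed.

End ExponentialVariable.

(** * Time averages *)

Section LinearGrowth.
Context {R : realType}.
Implicit Types (u v : nat -> R) (a b : R).

Lemma cvg_succ_div_index : N.+1%:R / N%:R @[N --> \oo] --> (1 : R).
Proof.
rewrite -cvg_shiftS.
have -> : (fun N : nat => N.+2%:R / N.+1%:R : R) = (fun N => 1 + harmonic N).
  by apply/funext => N; rewrite -natr1 mulrDl divff// mul1r.
have : 1 + harmonic N @[N --> \oo] --> (1 + 0 : R).
  by apply: cvgD; [exact: cvg_cst|exact: cvg_harmonic].
by rewrite addr0.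
Qed.

Lemma cvg_succ_linear_growth u a :
  u N / N%:R @[N --> \oo] --> a -> u N.+1 / N%:R @[N --> \oo] --> a.
Proof.
rewrite -(cvg_shiftS (fun N => u N / N%:R)) => ua.
have : u N.+1 / N.+1%:R * (N.+1%:R / N%:R) @[N --> \oo] --> a * 1.
  by apply: cvgM ua _; exact: cvg_succ_div_index.
rewrite mulr1; under eq_fun do rewrite mulrA divfK//.
exact.
Qed.

Lemma cvg_ratio_linear_growth u v a b : b != 0 ->
  u N / N%:R @[N --> \oo] --> a -> v N / N%:R @[N --> \oo] --> b ->
  u N / v N @[N --> \oo] --> a / b.
Proof.
move=> b0 ua vb.
have : u N / N%:R / (v N / N%:R) @[N --> \oo] --> a / b.
  by apply: cvgM => //; exact: cvgV.
apply: cvg_trans; apply: near_eq_cvg; near=> N.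
have N0 : N%:R != 0 :> R by rewrite pnatr_eq0 -lt0n; near: N; exact: nbhs_infty_gt.
by rewrite /= invf_div mulrA divfK.
Unshelve. all: by end_near. Qed.

Lemma linear_growth_unbounded u a : 0 < a ->
  u N / N%:R @[N --> \oo] --> a -> u N @[N --> \oo] --> +oo.
Proof.
move=> a0 ua; apply/cvgryPge => x; near=> N.
have N0 : 0 < N%:R :> R by rewrite ltr0n; near: N; exact: nbhs_infty_gt.
have : a / 2 <= u N / N%:R.
  near: N; apply: (cvgr_ge _ ua).
  by rewrite ltr_pdivrMr// ltr_pMr// ltr1n.
rewrite ler_pdivlMr//; apply: le_trans.
rewrite mulrC -ler_pdivrMr ?divr_gt0//; near: N.
exact: nbhs_infty_ger.
Unshelve. all: by end_near. Qed.

Lemma cvg0_bounded_div_index u a : (forall N, 0 <= u N <= a) ->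
  u N / N%:R @[N --> \oo] --> 0.
Proof.
move=> ua; have : a * N.+1%:R^-1 @[N --> \oo] --> a * 0.
  by apply: cvgM; [exact: cvg_cst|exact: cvg_harmonic].
rewrite mulr0 => a_harmonic.
rewrite -cvg_shiftS; apply: squeeze_cvgr (cvg_cst 0) a_harmonic.
apply: nearW => N; have /andP[u0 le_ua] := ua N.+1.
by rewrite divr_ge0//= ler_wpM2r.
Qed.

End LinearGrowth.

Section SampledTimeAverage.
Context {R : realType}.
Variables (f : R -> R) (tau G : nat -> R) (b g : R).
Notation mu := (@lebesgue_measure R).
Hypotheses (tau0 : tau 0%N = 0) (tau_nd : {homo tau : i j / (i <= j)%N >-> i <= j}).
Hypothesis mf : forall N, measurable_fun `[0, tau N[ f.
Hypothesis f0 : forall N t, 0 <= t < tau N -> 0 <= f t.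
Hypothesis integral_f : forall N, (\int[mu]_(t in `[0%R, tau N[) (f t)%:E = (G N)%:E)%E.
Hypotheses (b0 : 0 < b) (tau_b : tau N / N%:R @[N --> \oo] --> b).
Hypothesis G_g : G N / N%:R @[N --> \oo] --> g.

Let integral_between N t : tau N <= t < tau N.+1 ->
  ((G N)%:E <= \int[mu]_(s in `[0%R, t]) (f s)%:E <= (G N.+1)%:E)%E.
Proof.
move=> /andP[Nt tN].
have subt : `[0, t]%classic `<=` `[0, tau N.+1[%classic.
  by move=> s /=; rewrite !in_itv/= => /andP[-> /le_lt_trans]; apply.
have subN : `[0, tau N[%classic `<=` `[0, t]%classic.
  by move=> s /=; rewrite !in_itv/= => /andP[-> /ltW /le_trans]; apply.
have mft : measurable_fun `[0, t] f by exact: measurable_funS (@mf N.+1).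
rewrite -!integral_f; apply/andP; split; apply: ge0_subset_integral => //.
- exact/measurable_EFinP.
- by move=> s /subt/=; rewrite in_itv/= lee_fin; exact: f0.
- by apply/measurable_EFinP; exact: mf.
- by move=> s /=; rewrite in_itv/= lee_fin; exact: f0.
Qed.

Let exists_sample : exists idx : R -> nat,
  forall t, 0 <= t -> tau (idx t) <= t < tau (idx t).+1.
Proof.
suff sample t : exists N, 0 <= t -> tau N <= t < tau N.+1.
  by have [idx idxP] := choice sample; exists idx.
have [t0|_] := leP 0 t; last by exists 0%N.
have [M tM] : exists N, t < tau N.
  have /cvgryPgt/(_ t) := linear_growth_unbounded b0 tau_b.
  by case=> M _ /(_ M (leqnn M)); exists M.
have ex : exists N, t < tau N by exists M.
have := ex_minnP ex; case=> -[|N] tN minN; first by move: tN; rewrite tau0 ltNge t0.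
exists N => _; rewrite tN andbT leNgt; apply/negP => /minN.
by rewrite ltnn.
Qed.

Let sample_index_cvg (idx : R -> nat) :
  (forall t, 0 <= t -> tau (idx t) <= t < tau (idx t).+1) ->
  idx T @[T --> +oo] --> \oo.
Proof.
move=> idxP; apply/cvgnyPge => M; near=> T; rewrite leqNgt; apply/negP => /tau_nd TM.
have T0 : 0 <= T by near: T; apply: nbhs_pinfty_ge; exact: num_real.
have /andP[_ /lt_le_trans/(_ TM)] := idxP T T0.
by apply/negP; rewrite -leNgt; near: T; apply: nbhs_pinfty_ge; exact: num_real.
Unshelve. all: by end_near. Qed.

Let G_ge0 N : 0 <= G N.
Proof.
rewrite -lee_fin -integral_f; apply: integral_ge0 => t /=.
by rewrite in_itv/= lee_fin; exact: f0.
Qed.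

Let time_average_between T N : 0 < T -> 0 < tau N -> tau N <= T < tau N.+1 ->
  ((G N / tau N.+1)%:E <= (T^-1)%:E * \int[mu]_(t in `[0%R, T]) (f t)%:E
    <= (G N.+1 / tau N)%:E)%E.
Proof.
move=> T0 N0 NT; have /andP[Glow Gup] := integral_between NT.
have /andP[NT_le TN_lt] := NT.
rewrite (mulrC (G N)) (mulrC (G N.+1)) !EFinM; apply/andP; split.
  apply: le_trans (lee_wpmul2l _ Glow); last by rewrite lee_fin invr_ge0 ltW.
  by rewrite lee_wpmul2r ?lee_fin// lef_pV2 ?posrE ?ltW// (lt_trans T0).
apply: le_trans (lee_wpmul2l _ Gup) _; first by rewrite lee_fin invr_ge0 ltW.
by rewrite lee_wpmul2r ?lee_fin// lef_pV2 ?posrE.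
Qed.

Lemma time_average_cvg :
  ((T^-1)%:E * \int[mu]_(t in `[0%R, T]) (f t)%:E)%E @[T --> +oo] --> (g / b)%:E.
Proof.
have [idx idxP] := exists_sample; have idx_oo := sample_index_cvg idxP.
have b_neq0 : b != 0 by rewrite gt_eqF.
have lower : (G (idx T) / tau (idx T).+1)%:E @[T --> +oo] --> (g / b)%:E.
  apply: cvg_EFin; first exact: nearW.
  exact: cvg_comp idx_oo
    (cvg_ratio_linear_growth b_neq0 G_g (cvg_succ_linear_growth tau_b)).
have upper : (G (idx T).+1 / tau (idx T))%:E @[T --> +oo] --> (g / b)%:E.
  apply: cvg_EFin; first exact: nearW.
  exact: cvg_comp idx_oo
    (cvg_ratio_linear_growth b_neq0 (cvg_succ_linear_growth G_g) tau_b).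
have tau_idx_gt0 : \forall T \near +oo, 0 < tau (idx T).
  by have /cvgryPgt/(_ 0) := linear_growth_unbounded b0 tau_b; exact: idx_oo.
apply: squeeze_cvge lower upper; near=> T.
have T0 : 0 < T by near: T; exact: nbhs_pinfty_gt.
apply: time_average_between => //; last exact: idxP (ltW T0).
by near: T; exact: tau_idx_gt0.
Unshelve. all: by end_near. Qed.

End SampledTimeAverage.

Section Sawtooth.
Context {R : realType}.
Variables (f : R -> R) (tau base : nat -> R).
Notation mu := (@lebesgue_measure R).
Hypotheses (tau0 : tau 0%N = 0) (tau_nd : {homo tau : i j / (i <= j)%N >-> i <= j}).
Hypothesis base_le : forall j, base j <= tau j.
Hypothesis f_affine : forall j t, tau j <= t < tau j.+1 -> f t = t - base j.

Lemma integral_affine (a b c : R) : a <= b ->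
  (\int[mu]_(t in `[a, b[) (t - c)%:E = (((b - c) ^+ 2 - (a - c) ^+ 2) / 2)%:E)%E.
Proof.
rewrite le_eqVlt => /predU1P[->|ab].
  by rewrite set_itv_ge ?bnd_simp ?ltxx// integral_set0 subrr mul0r.
have dsub (t : R) := is_derive_shift (is_derive_id (t - c) (1 : R)).
have dF (t : R) : is_derive t 1 (fun t => (t - c) ^+ 2 / 2) (t - c).
  have -> : t - c = (t - c) * (t - c) * 0 + 2^-1 * ((t - c) * 1 + (t - c) * 1) by field.
  exact: is_derive_mul (is_derive_mul (dsub t) (dsub t)) (is_derive_cst (2^-1 : R) t 1).
have cF := is_derive_continuous dF.
rewrite integral_itv_bndo_bndc; last first.
  by apply/measurable_EFinP; exact: measurable_funB.
rewrite (@continuous_FTC2 _ _ (fun t => (t - c) ^+ 2 / 2))//.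
- by rewrite -EFinB mulrBl.
- exact: continuous_subspaceT (is_derive_continuous dsub).
- split; first by move=> t _; have [] := dF t.
  + by apply: cvg_at_right_filter; exact: cF.
  + by apply: cvg_at_left_filter; exact: cF.
- by move=> t _; rewrite derive1E; have [_ ->] := dF t.
Qed.

Let itvS N : `[0, tau N.+1[%classic = `[0, tau N[ `|` `[tau N, tau N.+1[ :> set R.
Proof.
have N0 : 0 <= tau N by rewrite -tau0; exact: tau_nd.
by rewrite -itv_bndbnd_setU// bnd_simp; exact: tau_nd.
Qed.

Lemma sawtooth_ge0 N t : 0 <= t < tau N -> 0 <= f t.
Proof.
elim: N => [|N IHN] /andP[t0 tN]; first by move: tN; rewrite tau0 ltNge t0.
have [tN'|tN'] := ltP t (tau N); first by apply: IHN; rewrite t0.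
by rewrite (f_affine (j := N)) ?tN'// subr_ge0 (le_trans (base_le N)).
Qed.

Let measurable_tooth N : measurable_fun `[tau N, tau N.+1[ f.
Proof.
have : measurable_fun `[tau N, tau N.+1[ (fun t => t - base N) by exact: measurable_funB.
by apply: eq_measurable_fun => t; rewrite inE/= in_itv/= => /f_affine ->.
Qed.

Lemma measurable_sawtooth N : measurable_fun `[0, tau N[ f.
Proof.
elim: N => [|N IHN].
  by rewrite tau0 set_itv_ge ?bnd_simp ?ltxx//; exact: measurable_fun_set0.
by rewrite itvS; apply/measurable_funU.
Qed.

Lemma integral_sawtooth N : (\int[mu]_(t in `[0%R, tau N[) (f t)%:E =
  (\sum_(0 <= j < N) ((tau j.+1 - base j) ^+ 2 - (tau j - base j) ^+ 2) / 2)%:E)%E.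
Proof.
elim: N => [|N IHN].
  by rewrite tau0 set_itv_ge ?bnd_simp ?ltxx// integral_set0 big_geq.
rewrite itvS ge0_integral_setU//; last 3 first.
- by rewrite -itvS; apply/measurable_EFinP; exact: measurable_sawtooth.
- by move=> t; rewrite -itvS/= in_itv/= lee_fin; exact: sawtooth_ge0.
- apply/disj_setPS => t /= []; rewrite /= !in_itv/= => /andP[_ tN] /andP[Nt _].
  by have := lt_le_trans tN Nt; rewrite ltxx.
rewrite IHN big_nat_recr//= EFinD; congr (_ + _)%E.
rewrite -integral_affine; last exact: tau_nd.
by apply: eq_integral => t; rewrite inE/= in_itv/= => /f_affine ->.
Qed.

End Sawtooth.

(** * Sample paths *)

Section Epochs.
Context {R : realType} {n : nat}.
Variables (k : nat) (len : 'I_n -> nat).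
Variables (A : nat -> R) (X : nat -> 'I_n) (C : nat -> bool).

Local Notation free_at := (free_at k len A X C).
Local Notation arrival := (arrival A).
Local Notation selected := (selected k X C).
Local Notation sent := (sent k len A X C).
Local Notation last_gen := (last_gen k len A X C).

Definition prior_arrival (j : nat) : R := \sum_(0 <= m < j) A m.

Definition codelen (j : nat) : R := (len (X j))%:R.

Definition max_len : R := \sum_(i < n) (len i)%:R.

(* Earliest time, after the first [j] arrivals, at which the transmitter is idle. *)
Definition epoch (j : nat) : R := Num.max (prior_arrival j) (free_at j).

Definition residual (j : nat) : R := epoch j - prior_arrival j.

Fixpoint generation (j : nat) : R :=
  if j is i.+1 then if sent i then arrival i else generation i else 0.

Definition age_at (j : nat) : R := epoch j - generation j.

Lemma arrivalE j : arrival j = prior_arrival j + A j.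
Proof. by rewrite /Defs.arrival /prior_arrival big_mkord big_ord_recr. Qed.

Lemma prior_arrivalS j : prior_arrival j.+1 = arrival j.
Proof. by rewrite arrivalE /prior_arrival big_nat_recr. Qed.

Lemma free_at_sent j : sent j -> free_at j.+1 = arrival j + codelen j.
Proof. by rewrite /Defs.sent /= => ->. Qed.

Lemma free_at_unsent j : ~~ sent j -> free_at j.+1 = free_at j.
Proof. by rewrite /Defs.sent /= => /negbTE ->. Qed.

Lemma codelen_ge0 j : 0 <= codelen j. Proof. by []. Qed.

Lemma max_len_ge0 : 0 <= max_len. Proof. exact: sumr_ge0. Qed.

Lemma codelen_le j : codelen j <= max_len.
Proof. by rewrite /max_len (bigD1 (X j))//= lerDl; exact: sumr_ge0. Qed.

Lemma residual_ge0 j : 0 <= residual j.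
Proof. by rewrite subr_ge0 le_max lexx. Qed.

Lemma epoch0 : epoch 0 = 0.
Proof. by rewrite /epoch /prior_arrival big_geq//= maxxx. Qed.

Lemma age_at0 : age_at 0 = 0.
Proof. by rewrite /age_at epoch0 subrr. Qed.

Hypothesis A0 : forall j, 0 <= A j.

Local Arguments Defs.free_at : simpl never.

Lemma free_at_le_arrival j : (free_at j <= arrival j) = (residual j <= A j).
Proof. by rewrite /residual lerBlDl -arrivalE /epoch ge_max arrivalE lerDl A0. Qed.

Lemma sentE j : sent j = (residual j <= A j) && selected j.
Proof. by rewrite /Defs.sent free_at_le_arrival. Qed.

(* Between epochs the transmitter either stays busy, or waits for the next
   arrival, which it possibly serves. *)
Lemma epochS j : epoch j.+1 = epoch j +
  (if residual j <= A j
   then A j - residual j + (if selected j then codelen j else 0) else 0).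
Proof.
have := sentE j; rewrite -free_at_le_arrival.
have -> : A j - residual j = arrival j - epoch j by rewrite arrivalE /residual; ring.
rewrite /epoch prior_arrivalS; case: leP => [idle|busy] /= sentj.
  case: ifPn (sentj) => [_|_] => [/free_at_sent|/negbT/free_at_unsent] ->.
    by rewrite max_r ?lerDl ?codelen_ge0//; ring.
  by rewrite max_l//; ring.
rewrite free_at_unsent ?sentj// max_r ?(ltW busy)// max_r ?addr0//.
by apply: le_trans (ltW busy); rewrite arrivalE lerDl.
Qed.

Lemma age_atS j : age_at j.+1 =
  if residual j <= A j then if selected j then codelen j
                            else age_at j + (A j - residual j)
  else age_at j.
Proof.
rewrite /age_at /= epochS sentE /residual; case: ifPn => _ /=; last by rewrite addr0.
by case: ifPn => _; [rewrite arrivalE|]; ring.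
Qed.

Lemma epoch_nd : {homo epoch : i j / (i <= j)%N >-> i <= j}.
Proof.
apply: homo_leq => [x|y x z|j]; [exact: lexx|exact: le_trans|].
rewrite epochS lerDl; case: ifPn => // idle.
by rewrite addr_ge0 ?subr_ge0//; case: ifPn.
Qed.

Lemma generation_sent j : sent j -> generation j.+1 = arrival j.
Proof. by rewrite /= => ->. Qed.

Lemma generation_le_free_at j : generation j <= free_at j.
Proof.
elim: j => //= j IHj; case: ifPn => [sj|/free_at_unsent -> //].
by rewrite free_at_sent// lerDl codelen_ge0.
Qed.

Lemma free_at_le_generation j : free_at j <= generation j + max_len.
Proof.
elim: j => [|j IHj] /=; first by rewrite add0r max_len_ge0.
case: ifPn => [sj|/free_at_unsent -> //].
by rewrite free_at_sent// lerD2l codelen_le.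
Qed.

Lemma generation_le_epoch j : generation j <= epoch j.
Proof. by rewrite le_max generation_le_free_at orbT. Qed.

Lemma age_at_ge0 j : 0 <= age_at j.
Proof. by rewrite subr_ge0 generation_le_epoch. Qed.

Lemma generation_nd : {homo generation : i j / (i <= j)%N >-> i <= j}.
Proof.
apply: homo_leq => [x|y x z|j]; [exact: lexx|exact: le_trans|].
rewrite /=; case: ifPn => // /andP[idle _].
exact: le_trans (generation_le_free_at j) idle.
Qed.

Lemma residual_le j : residual j <= max_len.
Proof.
suff : free_at j <= prior_arrival j + max_len.
  move=> free_le; rewrite lerBlDl ge_max free_le andbT lerDl.
  exact: max_len_ge0.
elim: j => [|j IHj]; first by rewrite addr_ge0 ?max_len_ge0// /prior_arrival big_geq.
rewrite prior_arrivalS; have [sj|/free_at_unsent ->] := boolP (sent j).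
  by rewrite free_at_sent// lerD2l codelen_le.
by rewrite (le_trans IHj)// lerD2r arrivalE lerDl.
Qed.

Lemma age_atS_le j : age_at j.+1 <= if selected j then max_len else age_at j + A j.
Proof.
rewrite age_atS; case: (leP (residual j) (A j)) => [idle|busy].
  by case: ifPn => _; [exact: codelen_le|rewrite lerD2l gerBl residual_ge0].
case: ifPn => _; last by rewrite lerDl.
suff -> : age_at j = free_at j - generation j.
  by rewrite lerBlDl free_at_le_generation.
rewrite /age_at /epoch max_r// leNgt; apply/negP => free_lt.
by move: busy; rewrite /residual /epoch max_l ?subrr ?(ltW free_lt)// ltNge A0.
Qed.

Let generation_mem j :
  generation j = 0 \/ exists2 i, (i < j)%N & sent i /\ generation j = arrival i.
Proof.
elim: j => [|j IHj] /=; first by left.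
case: ifPn => sj; first by right; exists j.
by case: IHj => [|[i ij iP]]; [left|right; exists i => //; exact: ltnW].
Qed.

Let sent_done_le i t : sent i -> arrival i + codelen i <= t -> epoch i.+1 <= t.
Proof.
move=> si; rewrite -free_at_sent// /epoch prior_arrivalS => free_le.
by rewrite ge_max free_le (le_trans _ free_le)// free_at_sent// lerDl codelen_ge0.
Qed.

Lemma last_gen_between j t : epoch j <= t < epoch j.+1 -> last_gen t = generation j.
Proof.
move=> /andP[jt tj]; rewrite /Defs.last_gen; set S := (S in sup S).
have Sgen : S (generation j).
  case: (generation_mem j) => [->|[i ij [si ->]]]; [by left|right; exists i; split => //].
  apply: le_trans jt; rewrite -/(codelen i) -free_at_sent//.
  by apply: le_trans (epoch_nd ij); rewrite le_max lexx orbT.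
have ubS : ubound S (generation j).
  move=> s [->|[i [si it ->]]]; first exact: (generation_nd (leq0n j)).
  rewrite -generation_sent//; apply: generation_nd; rewrite ltnNge; apply/negP => ji.
  by have := le_lt_trans (sent_done_le si it) tj; rewrite ltNge epoch_nd.
apply/eqP; rewrite eq_le; apply/andP; split.
  by apply: ge_sup => //; exists (generation j).
by apply: ub_le_sup => //; exists (generation j).
Qed.

Definition age_area (N : nat) : R :=
  \sum_(0 <= j < N) ((epoch j.+1 - generation j) ^+ 2 - age_at j ^+ 2) / 2.

Let age_between j t : epoch j <= t < epoch j.+1 ->
  age k len A X C t = t - generation j.
Proof. by move=> jt; rewrite /age (last_gen_between jt). Qed.

Lemma avg_age_cvg (a b : R) : 0 < b -> epoch N / N%:R @[N --> \oo] --> b ->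
  age_area N / N%:R @[N --> \oo] --> a ->
  avg_age k len A X C T @[T --> +oo] --> (a / b)%:E.
Proof.
move=> b0 epoch_b area_a; have e0 := epoch0; have nd := epoch_nd.
apply: (time_average_cvg e0 nd _ _ _ b0 epoch_b area_a).
- exact: measurable_sawtooth e0 nd age_between.
- exact: sawtooth_ge0 e0 generation_le_epoch age_between.
- exact: integral_sawtooth e0 nd generation_le_epoch age_between.
Qed.

End Epochs.

Definition selection {n : nat} (k : nat) (X : nat -> 'I_n) (C : nat -> bool) (j : nat) :
  option 'I_n := if selected k X C j then Some (X j) else None.

Section Excess.
Context {R : realType} {n : nat}.
Variables (len : 'I_n -> nat) (Delta cycle : R).

(* Change of [age_area - Delta * epoch + cycle * age_at] between two epochs, given the
   age [a] and the residual service [r] at the first one, when the next packet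
   arrives [x] after the previous one with selection [o]. *)
Definition idle_excess (a : R) (o : option 'I_n) (y : R) : R :=
  if o is Some i
  then ((a + y + (len i)%:R) ^+ 2 - a ^+ 2) / 2 - Delta * (y + (len i)%:R)
       + cycle * ((len i)%:R - a)
  else ((a + y) ^+ 2 - a ^+ 2) / 2 - Delta * y + cycle * y.

Definition excess (a r x : R) (o : option 'I_n) : R :=
  if r <= x then idle_excess a o (x - r) else 0.

Definition excess_coef0 (a : R) (o : option 'I_n) : R :=
  if o is Some i
  then a * (len i)%:R + (len i)%:R ^+ 2 / 2 + (cycle - Delta) * (len i)%:R - cycle * a else 0.

Definition excess_coef1 (a : R) (o : option 'I_n) : R :=
  a - Delta + (if o is Some i then (len i)%:R else cycle).

Lemma idle_excess_quadratic a o y : idle_excess a o y =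
  excess_coef0 a o + excess_coef1 a o * y + 2^-1 * y ^+ 2.
Proof.
by rewrite /idle_excess /excess_coef0 /excess_coef1; case: o => [i|]; field.
Qed.

Lemma normr_excess_le a r x o : 0 <= a -> 0 <= r -> 0 <= x ->
  `|excess a r x o| <= (1 + `|Delta| + `|cycle|) * (1 + (a + x + max_len len) ^+ 2).
Proof.
move=> a0 r0 x0; set b := a + x + max_len len.
have bound u v e : 0 <= u <= b ^+ 2 -> 0 <= v <= b -> - b <= e <= b ->
    `|u - Delta * v + cycle * e| <= (1 + `|Delta| + `|cycle|) * (1 + b ^+ 2).
  move=> /andP[u0 ub] /andP[v0 vb] eb.
  have b1 : b <= 1 + b ^+ 2 by have := sqr_ge0 (b - 1); nra.
  have Dv : `|Delta * v| <= `|Delta| * (1 + b ^+ 2).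
    by rewrite normrM (ger0_norm v0) ler_wpM2l// (le_trans vb).
  have ce : `|cycle * e| <= `|cycle| * (1 + b ^+ 2).
    by rewrite normrM ler_wpM2l// (le_trans _ b1)// ler_norml.
  rewrite (le_trans (ler_normD _ _))// (le_trans (lerD (ler_normB _ _) (lexx _)))//.
  by rewrite (ger0_norm u0) !mulrDl mul1r !lerD// (le_trans ub)// lerDr.
rewrite /excess /idle_excess; case: ifPn => [rx|_]; last first.
  by rewrite normr0 mulr_ge0 ?addr_ge0 ?sqr_ge0.
have ml0 : 0 <= max_len len :> R by exact: max_len_ge0.
case: o => [i|]; last by apply: bound; rewrite /b; nra.
have l0 : 0 <= (len i)%:R :> R by [].
have lb : (len i)%:R <= max_len len :> R by exact: codelen_le len (fun=> i) 0%N.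
by apply: bound; rewrite /b; nra.
Qed.

Section Potential.
Variables (k : nat) (A : nat -> R) (X : nat -> 'I_n) (C : nat -> bool).
Hypothesis A0 : forall j, 0 <= A j.

Local Notation epoch := (epoch k len A X C).
Local Notation residual := (residual k len A X C).
Local Notation age_at := (age_at k len A X C).
Local Notation age_area := (age_area k len A X C).
Local Notation selection := (selection k X C).

Definition potential (j : nat) : R :=
  age_area j - Delta * epoch j + cycle * age_at j.

Lemma potential0 : potential 0 = 0.
Proof. by rewrite /potential epoch0 age_at0 /age_area big_geq// !mulr0 subrr addr0. Qed.

Lemma potentialS j : potential j.+1 - potential j =
  excess (age_at j) (residual j) (A j) (selection j).
Proof.
rewrite /potential /age_area big_nat_recr//= age_atS// epochS// /excess /idle_excess.
have -> : epoch j = age_at j + generation k len A X C j by rewrite subrK.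
rewrite /codelen /selection; case: ifPn => _; last by rewrite !addr0; field.
by case: ifPn => _; field.
Qed.

Lemma potential_sum N : potential N =
  \sum_(0 <= j < N) excess (age_at j) (residual j) (A j) (selection j).
Proof.
under eq_bigr do rewrite -potentialS.
by rewrite telescope_sumr// potential0 subr0.
Qed.

Lemma avg_age_cvg_of_potential (b : R) : 0 < b ->
  prior_arrival A N / N%:R @[N --> \oo] --> b ->
  potential N / N%:R @[N --> \oo] --> 0 ->
  age_at N / N%:R @[N --> \oo] --> 0 ->
  avg_age k len A X C t @[t --> +oo] --> Delta%:E.
Proof.
move=> b0 prior_b potential_mean0 age_mean0.
have residual0 : residual N / N%:R @[N --> \oo] --> 0.
  by apply: (cvg0_bounded_div_index (a := max_len len)) => N; rewrite residual_ge0 residual_le.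
have epoch_b : epoch N / N%:R @[N --> \oo] --> b.
  rewrite -[X in _ --> X]addr0.
  have -> : (fun N => epoch N / N%:R) =
      (fun N => prior_arrival A N / N%:R + residual N / N%:R).
    by apply/funext => N; rewrite -mulrDl /residual subrKC.
  exact: cvgD.
have area_Db : age_area N / N%:R @[N --> \oo] --> Delta * b.
  have -> : Delta * b = 0 + Delta * b - cycle * 0 by rewrite add0r mulr0 subr0.
  have -> : (fun N => age_area N / N%:R) =
      (fun N => potential N / N%:R + Delta * (epoch N / N%:R)
        - cycle * (age_at N / N%:R)).
    by apply/funext => N; rewrite /potential; ring.
  by apply: cvgB; [apply: cvgD => //|]; apply: cvgM => //; exact: cvg_cst.
by have := avg_age_cvg A0 b0 epoch_b area_Db; rewrite mulfK// gt_eqF.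
Qed.

End Potential.
End Excess.

(** * Past and innovations *)

Section MartingaleDifferences.
Context {d : measure_display} {T : measurableType d} {R : realType}.
Variables (P : probability T R) (past next : nat -> set (set T)).
Hypotheses (past_meas : forall j, past j `<=` measurable)
  (next_meas : forall j, next j `<=` measurable).
Hypotheses (pastI : forall j, setI_closed (past j))
  (nextI : forall j, setI_closed (next j)).
Hypotheses (pastT : forall j, past j setT) (nextT : forall j, next j setT).
Hypothesis past_next : forall j, independent_systems P (past j) (next j).

Local Notation TP j := (g_sigma_algebraType (past j)).
Local Notation TN j := (g_sigma_algebraType (next j)).

Variables (g : nat -> T -> T -> R) (K : R).
Hypothesis mg : forall j, measurable_fun [set: TP j * TN j] (fun x => g j x.1 x.2).
Hypothesis g_past : forall i j, (i < j)%N -> measurable_fun [set: TP j] (fun w => g i w w).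
Hypothesis g_int : forall j w, P.-integrable setT (fun w' => (g j w w')%:E).
Hypothesis g_centered : forall j w, (\int[P]_w' (g j w w')%:E = 0)%E.
Hypothesis g_sqr : forall j, (\int[P]_w (g j w w ^+ 2)%:E <= K%:E)%E.

Let xi j w := g j w w.

Let mxi j : measurable_fun [set: T] (xi j).
Proof. exact: sub_sigma_measurable_fun (@past_meas j.+1) (g_past (ltnSn j)). Qed.

Lemma martingale_difference_orthogonal i j : (i < j)%N ->
  (\int[P]_w (g i w w * g j w w)%:E = 0)%E.
Proof.
move=> ij.
rewrite (integral_independent_systems (@past_meas j) (@next_meas j) (@pastI j)
  (@nextI j) (pastT j) (nextT j) (@past_next j) (g := fun w w' => g i w w * g j w w')).
- apply: integral0_eq => w _ /=; under eq_integral do rewrite EFinM.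
  by rewrite integralZl// g_centered mule0.
- apply: measurable_funM => //.
  exact: measurableT_comp (g_past ij) measurable_fst.
- apply: integrableM_of_sqr => //; [exact: mxi|exact: mxi| |].
    exact: integrable_sqr_of_le (mxi i) (@g_sqr i).
  exact: integrable_sqr_of_le (mxi j) (@g_sqr j).
Qed.

Lemma strong_law_martingale_difference :
  {ae P, forall w, (\sum_(0 <= j < N) g j w w) / N%:R @[N --> \oo] --> 0}.
Proof. exact: strong_law_orthogonal mxi g_sqr martingale_difference_orthogonal. Qed.

End MartingaleDifferences.

Section Cylinders.
Context {d : measure_display} {T : measurableType d} {R : realType}.
Variables (P : probability T R) (n : nat).
Variables (A : nat -> T -> R) (X : nat -> T -> 'I_n) (C : nat -> T -> bool).
Implicit Types (B : nat -> set R) (S : nat -> set 'I_n) (D : nat -> set bool).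
Implicit Types J : seq nat.

Definition rectangle JA JX JC B S D : set T :=
  \big[setI/setT]_(j <- JA) (A j @^-1` B j)
  `&` \big[setI/setT]_(j <- JX) (X j @^-1` S j)
  `&` \big[setI/setT]_(j <- JC) (C j @^-1` D j).

Definition cylinders JA JX JC : set (set T) :=
  [set E | exists B S D, (forall j, measurable (B j)) /\ E = rectangle JA JX JC B S D].

Local Notation TC JA JX JC := (g_sigma_algebraType (cylinders JA JX JC)).

Lemma rectangleP JA JX JC B S D w : rectangle JA JX JC B S D w <->
  [/\ forall j, j \in JA -> B j (A j w), forall j, j \in JX -> S j (X j w)
    & forall j, j \in JC -> D j (C j w)].
Proof.
rewrite /rectangle -!bigcap_seq; split.
  by move=> [[wB wS] wD]; split=> j jJ; [apply: wB|apply: wS|apply: wD].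
by move=> [wB wS wD]; split; [split|] => j jJ; [apply: wB|apply: wS|apply: wD].
Qed.

Lemma cylinders_setI_closed JA JX JC : setI_closed (cylinders JA JX JC).
Proof.
move=> _ _ [B [S [D [mB ->]]]] [B' [S' [D' [mB' ->]]]].
exists (fun j => B j `&` B' j), (fun j => S j `&` S' j), (fun j => D j `&` D' j).
split; first by move=> j; exact: measurableI.
apply/seteqP; split => w; rewrite /setI/= !rectangleP.
  move=> [[wB wS wD] [wB' wS' wD']].
  by split=> j jJ; split; do ?[exact: wB|exact: wB'|exact: wS|exact: wS'|exact: wD|exact: wD'].
move=> [wB wS wD].
by split; split=> j jJ; do ?[by case: (wB _ jJ)|by case: (wS _ jJ)|by case: (wD _ jJ)].
Qed.

Lemma cylinders_setT JA JX JC : cylinders JA JX JC setT.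
Proof.
exists (fun=> setT), (fun=> setT), (fun=> setT); split => //.
by apply/seteqP; split => w // _; apply/rectangleP.
Qed.

Lemma sub_cylinders JA JX JC JA' JX' JC' :
  {subset JA <= JA'} -> {subset JX <= JX'} -> {subset JC <= JC'} ->
  cylinders JA JX JC `<=` cylinders JA' JX' JC'.
Proof.
move=> sA sX sC _ [B [S [D [mB ->]]]].
exists (fun j => if j \in JA then B j else setT),
  (fun j => if j \in JX then S j else setT), (fun j => if j \in JC then D j else setT).
split; first by move=> j; case: ifP.
apply/seteqP; split => w /rectangleP[wB wS wD]; apply/rectangleP; split => j jJ.
- by case: ifPn => // /wB.
- by case: ifPn => // /wS.
- by case: ifPn => // /wD.
- by have := wB j (sA j jJ); rewrite jJ.
- by have := wS j (sX j jJ); rewrite jJ.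
- by have := wD j (sC j jJ); rewrite jJ.
Qed.

Lemma measurable_cylinders_arrival JA JX JC j : j \in JA ->
  measurable_fun [set: TC JA JX JC] (A j).
Proof.
move=> jJ _ B mB; rewrite setTI; apply: sub_sigma_algebra.
apply: (@sub_cylinders [:: j] [::] [::]) => //; first by move=> i; rewrite inE => /eqP ->.
exists (fun=> B), (fun=> setT), (fun=> setT); split => //.
by rewrite /rectangle big_seq1 !big_nil !setIT.
Qed.

Lemma measurable_cylinders_mark JA JX JC j (dU : measure_display) (U : measurableType dU)
    (f : 'I_n -> bool -> U) : j \in JX -> j \in JC ->
  measurable_fun [set: TC JA JX JC] (fun w => f (X j w) (C j w)).
Proof.
move=> jX jC _ Y mY; rewrite setTI.
have cyl (E : set 'I_n) (F : set bool) :
    <<s cylinders JA JX JC >> (X j @^-1` E `&` C j @^-1` F).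
  apply: sub_sigma_algebra.
  apply: (@sub_cylinders [::] [:: j] [:: j]) => //.
  - by move=> i; rewrite inE => /eqP ->.
  - by move=> i; rewrite inE => /eqP ->.
  exists (fun=> setT), (fun=> E), (fun=> F); split => //.
  by rewrite /rectangle !big_seq1 big_nil setTI.
rewrite (_ : _ @^-1` Y =
  (X j @^-1` [set i | Y (f i true)] `&` C j @^-1` [set true]) `|`
  (X j @^-1` [set i | Y (f i false)] `&` C j @^-1` [set false])).
  by apply: (@measurableU _ (TC JA JX JC)); exact: cyl.
apply/seteqP; split => w /=; first by case: (C j w) => ?; [left|right].
by move=> [[+ ->]|[+ ->]].
Qed.

Hypothesis mA : forall j, measurable_fun setT (A j).
Hypothesis mX : forall j i, measurable [set w | X j w = i].
Hypothesis mC : forall j, measurable [set w | C j w].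

Lemma cylinders_measurable JA JX JC : cylinders JA JX JC `<=` measurable.
Proof.
move=> _ [B [S [D [mB ->]]]]; rewrite /rectangle -!bigcap_seq.
apply: measurableI; first apply: measurableI.
- by apply: fin_bigcap_measurable => // j _; rewrite -[X in measurable X]setTI; exact: mA.
- apply: fin_bigcap_measurable => // j _.
  rewrite (_ : _ @^-1` _ = \bigcup_(i in S j) [set w | X j w = i]).
    by apply: fin_bigcup_measurable => // i _; exact: mX.
  by apply/seteqP; split => [w Sw|w [i Si /= ->]] //; exists (X j w).
- apply: fin_bigcap_measurable => // j _.
  have mCj : measurable_fun setT (C j).
    by apply: (measurable_fun_bool true); rewrite setTI; exact: mC.
  by rewrite -[X in measurable X]setTI; exact: mCj.
Qed.

Definition glue (Y : Type) J (f g : nat -> Y) j := if j \in J then f j else g j.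

Lemma glue_left (Y : Type) J (f g : nat -> Y) j : j \in J -> glue J f g j = f j.
Proof. by rewrite /glue => ->. Qed.

Lemma glue_right (Y : Type) J J' (f g : nat -> Y) j : uniq (J ++ J') ->
  j \in J' -> glue J f g j = g j.
Proof.
rewrite cat_uniq => /and3P[_ /hasPn disj _] /disj jJ.
by rewrite /glue (negbTE jJ).
Qed.

Lemma glue_forall (Y : Type) J J' (f g : nat -> Y) (Q : nat -> Y -> Prop) :
  uniq (J ++ J') ->
  (forall j, j \in J ++ J' -> Q j (glue J f g j)) <->
  (forall j, j \in J -> Q j (f j)) /\ (forall j, j \in J' -> Q j (g j)).
Proof.
move=> uJ; split=> [QJ|[Qf Qg] j].
  split=> j jJ; first by rewrite -(glue_left f g jJ); apply: QJ; rewrite mem_cat jJ.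
  by rewrite -(glue_right f g uJ jJ); apply: QJ; rewrite mem_cat jJ orbT.
rewrite mem_cat => /orP[jJ|jJ]; first by rewrite glue_left//; exact: Qf.
by rewrite (glue_right f g uJ jJ); exact: Qg.
Qed.

Lemma prode_glue (Y : Type) J J' (f g : nat -> Y) (Q : nat -> Y -> \bar R) :
  uniq (J ++ J') ->
  (\prod_(j <- J ++ J') Q j (glue J f g j) =
   \prod_(j <- J) Q j (f j) * \prod_(j <- J') Q j (g j))%E.
Proof.
move=> uJ; rewrite big_cat/=; congr (_ * _)%E; apply: eq_big_seq => j jJ.
  by rewrite glue_left.
by rewrite (glue_right f g uJ jJ).
Qed.

Lemma rectangle_glue JA JX JC JA' JX' JC' B S D B' S' D' :
  uniq (JA ++ JA') -> uniq (JX ++ JX') -> uniq (JC ++ JC') ->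
  rectangle JA JX JC B S D `&` rectangle JA' JX' JC' B' S' D' =
  rectangle (JA ++ JA') (JX ++ JX') (JC ++ JC')
    (glue JA B B') (glue JX S S') (glue JC D D').
Proof.
move=> uA uX uC; apply/seteqP; split => w; rewrite /setI/= !rectangleP.
  move=> [[wB wS wD] [wB' wS' wD']].
  split; [exact/(glue_forall B B' (fun j b => b (A j w)) uA)
         |exact/(glue_forall S S' (fun j b => b (X j w)) uX)
         |exact/(glue_forall D D' (fun j b => b (C j w)) uC)].
move=> [/(glue_forall B B' (fun j b => b (A j w)) uA)[wB wB']
        /(glue_forall S S' (fun j b => b (X j w)) uX)[wS wS']
        /(glue_forall D D' (fun j b => b (C j w)) uC)[wD wD']].
by [].
Qed.

Hypothesis indep : mutually_independent P A X C.

Lemma independent_cylinders JA JX JC JA' JX' JC' :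
  uniq (JA ++ JA') -> uniq (JX ++ JX') -> uniq (JC ++ JC') ->
  independent_systems P (cylinders JA JX JC) (cylinders JA' JX' JC').
Proof.
move=> uA uX uC _ _ [B [S [D [mB ->]]]] [B' [S' [D' [mB' ->]]]].
have := uA; rewrite cat_uniq => /and3P[uJA _ uJA'].
have := uX; rewrite cat_uniq => /and3P[uJX _ uJX'].
have := uC; rewrite cat_uniq => /and3P[uJC _ uJC'].
rewrite rectangle_glue// [in LHS]/rectangle indep//; last first.
  by move=> j; rewrite /glue; case: ifP.
rewrite (prode_glue _ _ (fun j b => P (A j @^-1` b)))//.
rewrite (prode_glue _ _ (fun j b => P (X j @^-1` b)))//.
rewrite (prode_glue _ _ (fun j b => P (C j @^-1` b)))//.
rewrite /rectangle !indep//.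
by rewrite [RHS]muleACA; congr (_ * _)%E; exact: muleACA.
Qed.

Section CylinderIntegral.
Variables JA JX JC JA' JX' JC' : seq nat.
Hypotheses (uA : uniq (JA ++ JA')) (uX : uniq (JX ++ JX')) (uC : uniq (JC ++ JC')).
Variable g : T -> T -> R.
Hypothesis mg :
  measurable_fun [set: TC JA JX JC * TC JA' JX' JC'] (fun x => g x.1 x.2).

Lemma measurable_cylinders_diagonal : measurable_fun [set: T] (fun w => g w w).
Proof.
by apply: (@measurable_diagonal _ _ _ (cylinders JA JX JC) (cylinders JA' JX' JC'));
  try exact: cylinders_measurable.
Qed.

Lemma ge0_integral_cylinders : (forall w w', 0 <= g w w') ->
  (\int[P]_w (g w w)%:E = \int[P]_w \int[P]_w' (g w w')%:E)%E.
Proof.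
move=> g0; apply: (@ge0_integral_independent_systems _ _ _ _
  (cylinders JA JX JC) (cylinders JA' JX' JC')) => //; try exact: cylinders_measurable;
  try exact: cylinders_setI_closed; try exact: cylinders_setT.
exact: independent_cylinders.
Qed.

Lemma integral_cylinders : P.-integrable setT (fun w => (g w w)%:E) ->
  (\int[P]_w (g w w)%:E = \int[P]_w \int[P]_w' (g w w')%:E)%E.
Proof.
move=> ig; apply: (@integral_independent_systems _ _ _ _
  (cylinders JA JX JC) (cylinders JA' JX' JC')) => //; try exact: cylinders_measurable;
  try exact: cylinders_setI_closed; try exact: cylinders_setT.
exact: independent_cylinders.
Qed.

End CylinderIntegral.

End Cylinders.

Section Innovations.
Context {d : measure_display} {T : measurableType d} {R : realType}.
Variables (P : probability T R) (n : nat).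
Variables (A : nat -> T -> R) (X : nat -> T -> 'I_n) (C : nat -> T -> bool).
Hypothesis mA : forall j, measurable_fun setT (A j).
Hypothesis mX : forall j i, measurable [set w | X j w = i].
Hypothesis mC : forall j, measurable [set w | C j w].
Hypothesis indep : mutually_independent P A X C.

Definition past (j : nat) : set (set T) :=
  cylinders A X C (iota 0 j) (iota 0 j) (iota 0 j).

Definition innovation (j : nat) : set (set T) := cylinders A X C [:: j] [:: j] [:: j].

Local Notation TP j := (g_sigma_algebraType (past j)).
Local Notation TI j := (g_sigma_algebraType (innovation j)).

Lemma measurable_past_arrival i j : (i < j)%N -> measurable_fun [set: TP j] (A i).
Proof. by move=> ij; apply: measurable_cylinders_arrival; rewrite mem_iota. Qed.

Lemma measurable_past_mark i j (dU : measure_display) (U : measurableType dU)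
    (f : 'I_n -> bool -> U) : (i < j)%N ->
  measurable_fun [set: TP j] (fun w => f (X i w) (C i w)).
Proof. by move=> ij; apply: measurable_cylinders_mark; rewrite mem_iota. Qed.

Lemma measurable_innovation_arrival j : measurable_fun [set: TI j] (A j).
Proof. by apply: measurable_cylinders_arrival; exact: mem_head. Qed.

Lemma measurable_innovation_mark j (dU : measure_display) (U : measurableType dU)
    (f : 'I_n -> bool -> U) :
  measurable_fun [set: TI j] (fun w => f (X j w) (C j w)).
Proof. by apply: measurable_cylinders_mark; exact: mem_head. Qed.

Lemma measurable_past_T j (f : T -> R) :
  measurable_fun [set: TP j] f -> measurable_fun [set: T] f.
Proof. by apply: sub_sigma_measurable_fun; exact: cylinders_measurable. Qed.

Let uniq_past_innovation j : uniq (iota 0 j ++ [:: j]).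
Proof. by rewrite cats1 rcons_uniq iota_uniq mem_iota ltnn. Qed.

Lemma measurable_past_innovation j (g : T -> T -> R) :
  measurable_fun [set: TP j * TI j] (fun x => g x.1 x.2) ->
  measurable_fun [set: T] (fun w => g w w).
Proof. exact: (measurable_cylinders_diagonal mA mX mC). Qed.

Lemma ge0_integral_past_innovation j (g : T -> T -> R) :
  measurable_fun [set: TP j * TI j] (fun x => g x.1 x.2) ->
  (forall w w', 0 <= g w w') ->
  (\int[P]_w (g w w)%:E = \int[P]_w \int[P]_w' (g w w')%:E)%E.
Proof. exact: (ge0_integral_cylinders mA mX mC indep). Qed.

Lemma strong_law_innovations (g : nat -> T -> T -> R) (K : R) :
  (forall j, measurable_fun [set: TP j * TI j] (fun x => g j x.1 x.2)) ->
  (forall i j, (i < j)%N -> measurable_fun [set: TP j] (fun w => g i w w)) ->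
  (forall j w, P.-integrable setT (fun w' => (g j w w')%:E)) ->
  (forall j w, \int[P]_w' (g j w w')%:E = 0)%E ->
  (forall j, \int[P]_w (g j w w ^+ 2)%:E <= K%:E)%E ->
  {ae P, forall w, (\sum_(0 <= j < N) g j w w) / N%:R @[N --> \oo] --> 0}.
Proof.
apply: (@strong_law_martingale_difference _ _ _ P past innovation).
- by move=> j; exact: cylinders_measurable.
- by move=> j; exact: cylinders_measurable.
- by move=> j; exact: cylinders_setI_closed.
- by move=> j; exact: cylinders_setI_closed.
- by move=> j; exact: cylinders_setT.
- by move=> j; exact: cylinders_setT.
- by move=> j; exact: independent_cylinders.
Qed.

End Innovations.

(** * The update system *)

Section MeasurableEpochs.
Context {d : measure_display} {T : measurableType d} {R : realType} {n : nat}.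
Variables (k : nat) (len : 'I_n -> nat).
Variables (A : nat -> T -> R) (X : nat -> T -> 'I_n) (C : nat -> T -> bool) (j : nat).
Hypothesis mA : forall i, (i < j)%N -> measurable_fun setT (A i).
Hypothesis mlen : forall i, (i < j)%N ->
  measurable_fun setT (fun w => codelen len (X^~ w) i : R).
Hypothesis mselected : forall i, (i < j)%N ->
  measurable_fun setT (fun w => selected k (X^~ w) (C^~ w) i).

Let measurable_arrival i : (i < j)%N ->
  measurable_fun setT (fun w => arrival (A^~ w) i).
Proof.
move=> ij; apply: measurable_sum => m; apply: mA.
by rewrite (leq_trans _ ij) ?ltn_ord.
Qed.

Let measurable_free_at_generation i : (i <= j)%N ->
  measurable_fun setT (fun w => free_at k len (A^~ w) (X^~ w) (C^~ w) i) /\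
  measurable_fun setT (fun w => generation k len (A^~ w) (X^~ w) (C^~ w) i).
Proof.
elim: i => [|i IHi] ij; first by split; exact: measurable_cst.
have [mfree mgen] := IHi (ltnW ij); have marr := measurable_arrival ij.
have msent : measurable_fun setT (fun w => sent k len (A^~ w) (X^~ w) (C^~ w) i).
  apply: measurable_and; last exact: mselected.
  exact: measurable_fun_ler.
split=> /=; apply: measurable_fun_ifT => //.
by apply: measurable_funD => //; exact: mlen.
Qed.

Let measurable_prior_arrival :
  measurable_fun setT (fun w => prior_arrival (A^~ w) j).
Proof.
rewrite /prior_arrival; under eq_fun do rewrite big_mkord.
by apply: measurable_sum => m; apply: mA.
Qed.

Lemma measurable_epoch :
  measurable_fun setT (fun w => epoch k len (A^~ w) (X^~ w) (C^~ w) j).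
Proof.
apply: measurable_maxr => //; exact: (measurable_free_at_generation (leqnn j)).1.
Qed.

Lemma measurable_residual :
  measurable_fun setT (fun w => residual k len (A^~ w) (X^~ w) (C^~ w) j).
Proof. by apply: measurable_funB => //; exact: measurable_epoch. Qed.

Lemma measurable_age_at :
  measurable_fun setT (fun w => age_at k len (A^~ w) (X^~ w) (C^~ w) j).
Proof.
apply: measurable_funB; first exact: measurable_epoch.
exact: (measurable_free_at_generation (leqnn j)).2.
Qed.

End MeasurableEpochs.

Lemma measurable_excess {d : measure_display} {T : measurableType d} {R : realType}
    {n : nat} (len : 'I_n -> nat) (Delta cycle : R)
    (a r x : T -> R) (o : T -> option 'I_n) :
  measurable_fun setT a -> measurable_fun setT r -> measurable_fun setT x ->
  (forall f : option 'I_n -> R, measurable_fun setT (fun w => f (o w))) ->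
  measurable_fun setT (fun w => excess len Delta cycle (a w) (r w) (x w) (o w)).
Proof.
move=> ma mr mx mo; apply: measurable_fun_ifT => //; first exact: measurable_fun_ler.
under eq_fun do rewrite idle_excess_quadratic /excess_coef1.
have mxr : measurable_fun setT (fun w => x w - r w) by exact: measurable_funB.
apply: measurable_funD; last by apply: measurable_funM => //; exact: measurable_funX.
apply: measurable_funD; last first.
  apply: measurable_funM => //; apply: measurable_funD; first exact: measurable_funB.
  exact: mo (fun o => if o is Some i then (len i)%:R else cycle).
pose slope o := if o is Some i then (len i)%:R - cycle else 0.
have -> : (fun w => excess_coef0 len Delta cycle (a w) (o w)) =
    (fun w => a w * slope (o w) + excess_coef0 len Delta cycle 0 (o w)).
  by apply/funext => w; rewrite /excess_coef0 /slope; case: (o w) => [i|]; ring.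
apply: measurable_funD; last exact: mo.
by apply: measurable_funM => //; exact: mo.
Qed.

Section SelectionWeights.
Context {R : realType} {n : nat}.
Variables (k : nat) (p : 'I_n -> R) (alpha : R).

Local Notation q := (q_ka k p alpha).
Local Notation p_alpha := (p_alpha k p alpha).

Lemma q_kaE : q = \sum_(i < n) (if (i < k)%N then p i else alpha * p i).
Proof.
rewrite /q_ka [RHS](bigID (fun i : 'I_n => (i < k)%N))/=; congr (_ + _).
  by apply: eq_bigr => i ->.
rewrite mulr_sumr; under [LHS]eq_bigl do rewrite leqNgt.
by apply: eq_bigr => i /negbTE ->.
Qed.

Lemma q_ka_le1 : alpha <= 1 -> (forall i, 0 <= p i) -> \sum_(i < n) p i = 1 -> q <= 1.
Proof.
move=> alpha1 p0 p1; rewrite q_kaE -p1; apply: ler_sum => i _.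
by case: ifPn => // _; rewrite ler_piMl.
Qed.

Lemma q_ka_gt0 : (0 < k)%N -> (k <= n)%N -> 0 <= alpha ->
  (forall i, 0 <= p i) -> \sum_(i < n) p i = 1 ->
  (forall i j : 'I_n, (i <= j)%N -> p j <= p i) -> 0 < q.
Proof.
move=> k0 kn alpha0 p0 p1 p_nincr; have n0 : (0 < n)%N := leq_trans k0 kn.
have p_first : 0 < p (Ordinal n0).
  rewrite lt_neqAle p0 andbT eq_sym; apply/eqP => pi0.
  suff : \sum_(i < n) p i = 0 by rewrite p1 => /eqP; rewrite oner_eq0.
  by apply: big1 => i _; apply/eqP; rewrite eq_le p0 andbT -pi0; exact: p_nincr.
rewrite q_kaE (bigD1 (Ordinal n0))//= k0 ltr_pwDl//.
by apply: sumr_ge0 => i _; case: ifPn => // _; exact: mulr_ge0.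
Qed.

Hypothesis q0 : 0 < q.

Lemma q_ka_p_alpha i : q * p_alpha i = if (i < k)%N then p i else alpha * p i.
Proof. by rewrite /Defs.p_alpha; case: ifPn => _; rewrite mulrC divfK// gt_eqF. Qed.

Lemma sum_p_alpha : \sum_(i < n) p_alpha i = 1.
Proof.
apply: (mulfI (lt0r_neq0 q0)); rewrite mulr1 mulr_sumr [RHS]q_kaE.
by apply: eq_bigr => i _; exact: q_ka_p_alpha.
Qed.

Variables (len : 'I_n -> nat) (lambda : R).
Hypotheses (lambda0 : 0 < lambda) (alpha0 : 0 <= alpha) (p0 : forall i, 0 <= p i).

Local Notation EL := (EL k p alpha len).
Local Notation EL2 := (EL2 k p alpha len).
Local Notation Delta := (Delta_alpha k p alpha lambda len).

Definition mean_cycle : R := EL + 1 / (q * lambda).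

Lemma mean_cycle_gt0 : 0 < mean_cycle.
Proof.
rewrite ltr_wpDl ?divr_gt0 ?mulr_gt0//; apply: sumr_ge0 => i _; apply: mulr_ge0 => //.
by rewrite /Defs.p_alpha; case: ifPn => _; rewrite divr_ge0 ?mulr_ge0// ltW.
Qed.

Lemma Delta_alphaE : Delta = mean_cycle + EL2 / (2 * mean_cycle).
Proof.
have := mean_cycle_gt0; rewrite /Delta_alpha /mean_cycle.
have -> : EL2 + 2 / (q * lambda) * EL + 2 / (q * lambda) ^+ 2 =
    EL2 + 2 * (1 / (q * lambda)) * EL + 2 * (1 / (q * lambda)) ^+ 2.
  by field; rewrite !gt_eqF.
by move: (1 / (q * lambda)) => m c0; field; rewrite gt_eqF.
Qed.

(* [idle_excess_quadratic], integrated against the exponential law. *)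
Definition excess_mean (a : R) (o : option 'I_n) : R :=
  excess_coef0 len Delta mean_cycle a o + excess_coef1 len Delta mean_cycle a o / lambda
  + 2^-1 * 2 / lambda ^+ 2.

Lemma sum_p_alpha_excess_mean a :
  \sum_(i < n) p_alpha i * excess_mean a (Some i) =
  (a + mean_cycle - Delta + 1 / lambda) * EL + 2^-1 * EL2
    + ((a - Delta) / lambda - mean_cycle * a + 1 / lambda ^+ 2).
Proof.
rewrite /excess_mean; move: Delta mean_cycle => rate cycle.
rewrite -[X in _ = _ + X]mulr1 -[X in _ = _ + _ * X]sum_p_alpha /Defs.EL /Defs.EL2.
rewrite !mulr_sumr -!big_split/=.
by apply: eq_bigr => i _; rewrite /excess_coef1; field; rewrite gt_eqF.
Qed.

(* This balance equation determines the long term average age. *)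
Lemma mean_excess_eq0 a :
  q * (\sum_(i < n) p_alpha i * excess_mean a (Some i)) +
  (1 - q) * excess_mean a None = 0.
Proof.
rewrite sum_p_alpha_excess_mean /excess_mean /excess_coef0 /excess_coef1 Delta_alphaE.
have := mean_cycle_gt0; rewrite /mean_cycle; move: EL EL2 => e e2 c0.
field; rewrite !gt_eqF//=.
have -> : e * (q * lambda) + 1 = (e + 1 / (q * lambda)) * (q * lambda).
  by field; rewrite !gt_eqF.
by rewrite !mulr_gt0.
Qed.

End SelectionWeights.

Section Selection.
Context {R : realType} {d : measure_display} {T : measurableType d}.
Variables (P : probability T R) (n k : nat) (p : 'I_n -> R) (alpha : R).
Variables (A : nat -> T -> R) (X : nat -> T -> 'I_n) (C : nat -> T -> bool).
Hypothesis mA : forall j, measurable_fun setT (A j).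
Hypothesis mX : forall j i, measurable [set w | X j w = i].
Hypothesis mC : forall j, measurable [set w | C j w].
Hypothesis X_pmf : forall j i, P [set w | X j w = i] = (p i)%:E.
Hypothesis C_prob : forall j, P [set w | C j w] = alpha%:E.
Hypothesis indep : mutually_independent P A X C.

Local Notation q := (q_ka k p alpha).
Local Notation p_alpha := (p_alpha k p alpha).
Local Notation sel j w := (selection k (X^~ w) (C^~ w) j).
Local Notation arrival_system j := (cylinders A X C [:: j] [::] [::]).
Local Notation mark_system j := (cylinders A X C [::] [:: j] [:: j]).

Lemma measurable_selection JA JX JC j (dU : measure_display) (U : measurableType dU)
    (f : option 'I_n -> U) : j \in JX -> j \in JC ->
  measurable_fun [set: g_sigma_algebraType (cylinders A X C JA JX JC)]
    (fun w => f (sel j w)).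
Proof.
move=> jX jC.
exact: (@measurable_cylinders_mark _ _ _ _ A X C JA JX JC j _ _
  (fun x c => f (if (x < k)%N || c then Some x else None))).
Qed.

Hypothesis q0 : 0 < q.

Lemma probability_selection j i :
  P [set w | sel j w = Some i] = (q * p_alpha i)%:E.
Proof.
rewrite q_ka_p_alpha//; case: ifPn => ik.
  rewrite -(X_pmf j i); congr (P _); apply/seteqP; split=> w /=.
    by rewrite /selection; case: ifPn => // _ [].
  by move=> Xi; rewrite /selection /selected Xi ik.
have := indep (JA := [::]) (JX := [:: j]) (JC := [:: j]) (B := fun=> setT)
  (fun=> [set i]) (fun=> [set true]) isT isT isT (fun=> measurableT).
rewrite !big_nil !big_seq1 setTI mul1e => indepXC.
rewrite mulrC EFinM -(X_pmf j i) -(C_prob j) -[RHS]indepXC.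
congr (P _); apply/seteqP; split=> w /=.
  by rewrite /selection /selected; case: ifPn => // + [Xi]; rewrite Xi (negbTE ik).
by move=> [Xi Cj]; rewrite /selection /selected Xi Cj orbT.
Qed.

Lemma measurable_selection_eq j i : measurable_fun [set: g_sigma_algebraType (mark_system j)]
  (fun w => (sel j w == Some i)%:R : R).
Proof.
by apply: (measurable_selection (fun o => (o == Some i)%:R : R)); exact: mem_head.
Qed.

Lemma measurable_selection_eqT j i :
  measurable_fun [set: T] (fun w => (sel j w == Some i)%:R : R).
Proof.
by apply: sub_sigma_measurable_fun (@measurable_selection_eq j i); exact: cylinders_measurable.
Qed.

Lemma integral_selection_eq j i :
  P.-integrable setT (fun w => ((sel j w == Some i)%:R)%:E) /\
  (\int[P]_w ((sel j w == Some i)%:R)%:E = (q * p_alpha i)%:E)%E.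
Proof.
have mE : measurable [set w | sel j w = Some i].
  have -> : [set w | sel j w = Some i] =
      (fun w => (sel j w == Some i)%:R) @^-1` [set (1 : R)].
    apply/seteqP; split=> w /=; first by move=> ->; rewrite eqxx.
    by case: eqP => // _ /esym/eqP; rewrite oner_eq0.
  by rewrite -[X in measurable X]setTI; apply: measurable_selection_eqT.
have -> : (fun w => ((sel j w == Some i)%:R : R)%:E) =
    (fun w => (\1_[set w | sel j w = Some i] w)%:E).
  apply/funext => w; rewrite indicE.
  by case: eqP => [seli|seli]; [rewrite mem_set|rewrite memNset].
split; first exact: integrable_indic.
by rewrite integral_indic// setIT; exact: probability_selection.
Qed.

Lemma integral_arrival_selection j i (h : R -> R) :
  measurable_fun setT h -> P.-integrable setT (fun w => (h (A j w))%:E) ->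
  P.-integrable setT (fun w => ((sel j w == Some i)%:R * h (A j w))%:E) /\
  (\int[P]_w ((sel j w == Some i)%:R * h (A j w))%:E =
   (q * p_alpha i)%:E * \int[P]_w (h (A j w))%:E)%E.
Proof.
move=> mh h_int; have [sel_int sel_mean] := integral_selection_eq j i.
have prod_int : P.-integrable setT (fun w => ((sel j w == Some i)%:R * h (A j w))%:E).
  apply: le_integrable h_int => //.
    apply/measurable_EFinP; apply: measurable_funM; first exact: measurable_selection_eqT.
    exact: measurableT_comp.
  by move=> w _; rewrite lee_fin normrM; case: eqP; rewrite ?normr1 ?mul1r ?normr0 ?mul0r.
split=> //.
rewrite (@integral_cylinders _ _ _ _ _ A X C mA mX mC indep [:: j] [::] [::] [::] [:: j] [:: j]
  _ _ _ (fun w w' => (sel j w' == Some i)%:R * h (A j w)))//; last first.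
  apply: measurable_funM.
    exact: measurableT_comp (@measurable_selection_eq j i) measurable_snd.
  have marr : measurable_fun [set: g_sigma_algebraType (arrival_system j)] (A j).
    by apply: measurable_cylinders_arrival; exact: mem_head.
  by apply: measurableT_comp mh _; exact: measurableT_comp marr measurable_fst.
rewrite -integralZl//; apply: eq_integral => w _.
by under eq_integral do rewrite EFinM; rewrite integralZr// sel_mean.
Qed.

Lemma integral_selection j (f : option 'I_n -> R -> R) (m : option 'I_n -> R) :
  (forall o, measurable_fun setT (f o)) ->
  (forall o, P.-integrable setT (fun w => (f o (A j w))%:E)) ->
  (forall o, \int[P]_w (f o (A j w))%:E = (m o)%:E)%E ->
  P.-integrable setT (fun w => (f (sel j w) (A j w))%:E) /\
  (\int[P]_w (f (sel j w) (A j w))%:E =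
   (q * (\sum_(i < n) p_alpha i * m (Some i)) + (1 - q) * m None)%:E)%E.
Proof.
move=> mf fint fm.
have decompose w : (f (sel j w) (A j w))%:E = ((f None (A j w))%:E +
    \sum_(i < n) ((sel j w == Some i)%:R * (f (Some i) (A j w) - f None (A j w)))%:E)%E.
  rewrite sumEFin -EFinD; congr EFin; case: (sel j w) => [i|].
    rewrite (bigD1 i)//= eqxx mul1r big1 ?addr0 ?subrKC// => i' i'i.
    by rewrite (negbTE (_ : Some i != Some i')) ?mul0r// (inj_eq Some_inj) eq_sym.
  by rewrite big1 ?addr0// => i _; rewrite mul0r.
have diff_int i : P.-integrable setT (fun w => (f (Some i) (A j w) - f None (A j w))%:E).
  by under eq_fun do rewrite EFinB; exact: integrableB.
have part i := integral_arrival_selection i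
  (measurable_funB (mf (Some i)) (mf None)) (diff_int i).
have sum_int : P.-integrable setT (fun w => \sum_(i < n)
    ((sel j w == Some i)%:R * (f (Some i) (A j w) - f None (A j w)))%:E)%E.
  by apply: integrable_sum => // i _; exact: (part i).1.
under eq_fun do rewrite decompose.
split; first exact: integrableD.
rewrite integralD// integral_sum//; last by move=> i; exact: (part i).1.
rewrite fm.
have partE i : (\int[P]_w ((sel j w == Some i)%:R *
    (f (Some i) (A j w) - f None (A j w)))%:E =
    (q * p_alpha i * (m (Some i) - m None))%:E)%E.
  rewrite (part i).2 [RHS]EFinM; congr (_ * _)%E.
  by under eq_integral do rewrite EFinB; rewrite integralB// !fm.
under eq_bigr do rewrite partE.
rewrite sumEFin -EFinD; congr EFin.
under eq_bigr do rewrite mulrBr.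
rewrite sumrB -mulr_suml -mulr_sumr sum_p_alpha// mulr_sumr.
under eq_bigr do rewrite -mulrA.
ring.
Qed.

End Selection.

Section UpdateSystem.
Context {R : realType} {d : measure_display} {T : measurableType d}.
Variables (P : probability T R) (n k : nat) (p : 'I_n -> R) (len : 'I_n -> nat).
Variables (alpha lambda : R).
Variables (A : nat -> T -> R) (X : nat -> T -> 'I_n) (C : nat -> T -> bool).
Hypotheses (lambda0 : 0 < lambda) (alpha0 : 0 <= alpha) (p0 : forall i, 0 <= p i).
Hypotheses (q0 : 0 < q_ka k p alpha) (q1 : q_ka k p alpha <= 1).
Hypothesis mA : forall j, measurable_fun setT (A j).
Hypothesis mX : forall j i, measurable [set w | X j w = i].
Hypothesis mC : forall j, measurable [set w | C j w].
Hypothesis A0 : forall j w, 0 <= A j w.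
Hypothesis A_cdf : forall j s, 0 <= s ->
  P [set w | A j w <= s] = (1 - expR (- lambda * s))%:E.
Hypothesis X_pmf : forall j i, P [set w | X j w = i] = (p i)%:E.
Hypothesis C_prob : forall j, P [set w | C j w] = alpha%:E.
Hypothesis indep : mutually_independent P A X C.

Local Notation q := (q_ka k p alpha).
Local Notation p_alpha := (p_alpha k p alpha).
Local Notation Delta := (Delta_alpha k p alpha lambda len).
Local Notation cycle := (mean_cycle k p alpha len lambda).
Local Notation sel j w := (selection k (X^~ w) (C^~ w) j).
Local Notation agew j w := (age_at k len (A^~ w) (X^~ w) (C^~ w) j).
Local Notation resw j w := (residual k len (A^~ w) (X^~ w) (C^~ w) j).
Local Notation longest := (max_len len : R).
Local Notation TP j := (g_sigma_algebraType (past A X C j)).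
Local Notation TI j := (g_sigma_algebraType (innovation A X C j)).

Let selection_mean := integral_selection mA mX mC X_pmf C_prob indep q0.

Let arrival_quadratic_mean j :=
  integral_exponential_quadratic lambda0 (mA j) (A0 j) (A_cdf j).

Lemma measurable_past_age_residual i j : (i <= j)%N ->
  measurable_fun [set: TP j] (fun w => agew i w) /\
  measurable_fun [set: TP j] (fun w => resw i w).
Proof.
move=> ij.
have mj m (mi : (m < i)%N) : (m < j)%N := leq_trans mi ij.
have mAm m (mi : (m < i)%N) := @measurable_past_arrival _ _ _ _ A X C _ _ (mj m mi).
have mlen m (mi : (m < i)%N) :=
  @measurable_past_mark _ _ _ _ A X C _ _ _ _ (fun x _ => (len x)%:R : R) (mj m mi).
have mselected m (mi : (m < i)%N) :=
  @measurable_past_mark _ _ _ _ A X C _ _ _ _ (fun x c => (x < k)%N || c) (mj m mi).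
by split; [apply: (@measurable_age_at _ (TP j))|apply: (@measurable_residual _ (TP j))].
Qed.

Lemma integral_excess j a r : 0 <= r ->
  P.-integrable setT (fun w => (excess len Delta cycle a r (A j w) (sel j w))%:E) /\
  (\int[P]_w (excess len Delta cycle a r (A j w) (sel j w))%:E = 0)%E.
Proof.
move=> r0.
have mean o := integral_exceedance_quadratic lambda0 (mA j) (A0 j) (A_cdf j) r0
  (idle_excess_quadratic len Delta cycle a o).
have mexcess o : measurable_fun setT (fun x => excess len Delta cycle a r x o).
  exact: measurable_excess.
have [int_excess ->] := selection_mean mexcess (fun o => (mean o).1) (fun o => (mean o).2).
split=> //; congr EFin; under eq_bigr do rewrite mulrA.
by rewrite -mulr_suml !mulrA -mulrDl mean_excess_eq0// mul0r.
Qed.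

Local Notation theta := (q * lambda / 2).
Local Notation mgf := (lambda / (lambda - theta)).

Let theta0 : 0 < theta. Proof. by rewrite divr_gt0// mulr_gt0. Qed.

Let theta_lt : theta < lambda.
Proof. by have := lambda0; have := q1; nra. Qed.

Let mgf0 : 0 <= mgf. Proof. by rewrite divr_ge0 ?subr_ge0 ?ltW. Qed.

(* A selected packet resets the age, so its exponential moment contracts. *)
Let mgf_contraction : (1 - q) * mgf <= 1 - q / 2.
Proof.
rewrite mulrA ler_pdivrMr ?subr_gt0//.
rewrite -subr_ge0.
have -> : (1 - q / 2) * (lambda - theta) - (1 - q) * lambda = lambda * (q / 2) ^+ 2 by field.
by rewrite mulr_ge0 ?sqr_ge0// ltW.
Qed.

Let integral_expR_arrival j : (\int[P]_w (expR (theta * A j w))%:E = mgf%:E)%E.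
Proof. exact: (integral_expR_exponential lambda0 (mA j) (A0 j) (A_cdf j) theta_lt). Qed.

Let integrable_expR_arrival j : P.-integrable setT (fun w => (expR (theta * A j w))%:E).
Proof.
apply/integrableP; split.
  by apply/measurable_EFinP; apply: measurableT_comp => //; exact: measurable_funM.
under eq_integral do rewrite gee0_abs ?lee_fin ?expR_ge0//.
by rewrite integral_expR_arrival ltry.
Qed.

Let measurable_expR_age j :
  measurable_fun [set: TP j] (fun w => expR (theta * agew j w)).
Proof.
apply: measurableT_comp => //; apply: measurable_funM => //.
exact: (measurable_past_age_residual (leqnn j)).1.
Qed.

Let measurable_age_T j : measurable_fun [set: T] (fun w => agew j w).
Proof.
exact: (measurable_past_T mA mX mC (measurable_past_age_residual (leqnn j)).1).
Qed.

Let measurable_expR_age_T j : measurable_fun [set: T] (fun w => expR (theta * agew j w)).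
Proof. by apply: measurableT_comp => //; exact: measurable_funM. Qed.

Let measurable_selection_innovation j (dU : measure_display) (U : measurableType dU)
    (f : option 'I_n -> U) : measurable_fun [set: TP j * TI j] (fun x => f (sel j x.2)).
Proof.
pose mark (x : 'I_n) b : U := f (if (x < k)%N || b then Some x else None).
exact: measurableT_comp (@measurable_innovation_mark _ _ _ _ A X C j _ _ mark) measurable_snd.
Qed.

Let measurable_arrival_innovation j :
  measurable_fun [set: TP j * TI j] (fun x => A j x.2).
Proof.
exact: measurableT_comp (@measurable_innovation_arrival _ _ _ _ A X C j) measurable_snd.
Qed.

Let expR_age_arrival j w w' := expR (theta * agew j w) * expR (theta * A j w').

Let measurable_expR_age_arrival j :
  measurable_fun [set: TP j * TI j] (fun x => expR_age_arrival j x.1 x.2).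
Proof.
apply: measurable_funM; first exact: measurableT_comp (@measurable_expR_age j) measurable_fst.
by apply: measurableT_comp => //; exact: measurable_funM.
Qed.

Lemma integral_expR_age_arrival j :
  (\int[P]_w (expR (theta * (agew j w + A j w)))%:E =
   mgf%:E * \int[P]_w (expR (theta * agew j w))%:E)%E.
Proof.
under eq_integral do rewrite mulrDr expRD.
have exp_ge0 w w' : 0 <= expR_age_arrival j w w' by rewrite mulr_ge0// expR_ge0.
rewrite (ge0_integral_past_innovation mA mX mC indep (@measurable_expR_age_arrival j))//.
rewrite -ge0_integralZl_EFin//; last exact/measurable_EFinP.
apply: eq_integral => w _; under eq_integral do rewrite EFinM.
by rewrite integralZl// integral_expR_arrival muleC.
Qed.

(* [sel j w'] is coerced to the boolean telling that packet [j] is selected. *)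
Let age_bound j w w' : R :=
  if sel j w' then expR (theta * longest) else expR_age_arrival j w w'.

Let expR_ageS_le j w : expR (theta * agew j.+1 w) <= age_bound j w w.
Proof.
have := age_atS_le k len (X^~ w) (C^~ w) (A0^~ w) j.
rewrite /age_bound /selection /expR_age_arrival -expRD -mulrDr.
by case: ifPn => _ age_le; rewrite ler_expR ler_pM2l.
Qed.

Let age_bound_ge0 j w w' : 0 <= age_bound j w w'.
Proof. by rewrite /age_bound; case: ifPn => _; rewrite ?mulr_ge0 ?expR_ge0. Qed.

Let measurable_age_bound j :
  measurable_fun [set: TP j * TI j] (fun x => age_bound j x.1 x.2).
Proof.
apply: measurable_fun_ifT => //; exact: (@measurable_selection_innovation j _ _ isSome).
Qed.

Let integral_age_bound j w : (\int[P]_w' (age_bound j w w')%:E =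
  (q * expR (theta * longest) + (1 - q) * mgf * expR (theta * agew j w))%:E)%E.
Proof.
pose f (o : option 'I_n) x :=
  if o then expR (theta * longest) else expR (theta * agew j w) * expR (theta * x).
pose m (o : option 'I_n) :=
  if o then expR (theta * longest) else expR (theta * agew j w) * mgf.
have mf o : measurable_fun setT (f o).
  case: o => [i|]; rewrite /f/=; first exact: measurable_cst.
  apply: measurable_funM => //; apply: measurableT_comp => //; exact: measurable_funM.
have f_int o : P.-integrable setT (fun w' => (f o (A j w'))%:E).
  case: o => [i|]; first exact: finite_measure_integrable_cst.
  by rewrite /f; under eq_fun do rewrite EFinM; exact: integrableZl.
have f_mean o : (\int[P]_w' (f o (A j w'))%:E = (m o)%:E)%E.
  case: o => [i|]; first exact: integral_probability_cst.
  rewrite /f; under eq_integral do rewrite EFinM.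
  by rewrite integralZl// integral_expR_arrival.
rewrite (selection_mean mf f_int f_mean).2 -mulr_suml sum_p_alpha// mul1r /m/=.
by congr EFin; ring.
Qed.

Lemma integral_expR_age_le j :
  (\int[P]_w (expR (theta * agew j w))%:E <= (2 * expR (theta * longest))%:E)%E.
Proof.
have longest0 := expR_ge0 (theta * longest).
elim: j => [|j IHj].
  under eq_integral do rewrite age_at0 mulr0 expR0.
  rewrite integral_probability_cst lee_fin.
  have : 1 <= expR (theta * longest).
    by rewrite -[leLHS]expR0 ler_expR mulr_ge0 ?max_len_ge0 ?ltW.
  lra.
apply: (@le_trans _ _ (\int[P]_w (age_bound j w w)%:E)%E).
  apply: ge0_le_integral => //.
  - exact/measurable_EFinP.
  - apply/measurable_EFinP.
    exact: (measurable_past_innovation mA mX mC (@measurable_age_bound j)).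
  - by move=> w _; rewrite lee_fin expR_ageS_le.
rewrite (ge0_integral_past_innovation mA mX mC indep (@measurable_age_bound j))//.
under eq_integral do rewrite integral_age_bound EFinD (EFinM ((1 - q) * mgf)).
have contraction0 : 0 <= (1 - q) * mgf by rewrite mulr_ge0 ?subr_ge0.
rewrite ge0_integralD//; last 3 first.
- by move=> w _; rewrite lee_fin mulr_ge0// ltW.
- by move=> w _; rewrite -EFinM lee_fin mulr_ge0// expR_ge0.
- by apply/measurable_EFinP; exact: measurable_funM.
rewrite integral_probability_cst ge0_integralZl_EFin//; last first.
  exact/measurable_EFinP.
apply: le_trans (leeD2l _ (lee_wpmul2l _ IHj)) _; first by rewrite lee_fin.
by rewrite -EFinM -EFinD lee_fin; have := mgf_contraction; nra.
Qed.

Let moment_bound : R := mgf * (2 * expR (theta * longest)).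

Lemma integral_sqr_le_expR (f : T -> R) (a : R) j : measurable_fun setT f -> 0 <= a ->
  (forall w, f w ^+ 2 <= a * expR (theta * (agew j w + A j w))) ->
  (\int[P]_w (f w ^+ 2)%:E <= (a * moment_bound)%:E)%E.
Proof.
move=> mf a0 fa.
have mexp : measurable_fun setT (fun w => expR (theta * (agew j w + A j w))).
  by apply: measurableT_comp => //; apply: measurable_funM => //; exact: measurable_funD.
apply: (@le_trans _ _ (\int[P]_w (a%:E * (expR (theta * (agew j w + A j w)))%:E))%E).
  apply: ge0_le_integral => //.
  - by move=> w _; rewrite lee_fin sqr_ge0.
  - by apply/measurable_EFinP; exact: measurable_funX.
  - by apply/measurable_EFinP; exact: measurable_funM.
  - by move=> w _; rewrite -EFinM lee_fin.
rewrite ge0_integralZl_EFin//; last exact/measurable_EFinP.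
rewrite integral_expR_age_arrival /moment_bound !EFinM lee_wpmul2l ?lee_fin//.
by rewrite lee_wpmul2l ?lee_fin// -EFinM; exact: integral_expR_age_le.
Qed.

Let growth := quad_expR_ratio theta.

Let growth_ge0 : 0 <= growth.
Proof. by rewrite mulr_ge0// addr_ge0// divr_ge0// exprn_ge0// ltW. Qed.

Let age_ge0 j w : 0 <= agew j w.
Proof. exact: age_at_ge0. Qed.

Lemma integral_sqr_age_le j :
  (\int[P]_w (agew j w ^+ 2)%:E <= (growth * moment_bound)%:E)%E.
Proof.
apply: (integral_sqr_le_expR (j := j)) => // w.
apply: (@le_trans _ _ (growth * expR (theta * agew j w))).
  apply: le_trans (sqr_quad_le_expR theta0 (age_ge0 j w)).
  by have := sqr_ge0 (agew j w); nra.
by rewrite ler_wpM2l// ler_expR ler_pM2l// lerDl.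
Qed.

Let excessw j w w' := excess len Delta cycle (agew j w) (resw j w) (A j w') (sel j w').

Let excess_scale := (1 + `|Delta| + `|cycle|) ^+ 2 * growth * expR (theta * longest).

Let sqr_excess_le j w :
  excessw j w w ^+ 2 <= excess_scale * expR (theta * (agew j w + A j w)).
Proof.
have b0 : 0 <= agew j w + A j w + longest.
  by apply: addr_ge0; [exact: addr_ge0|exact: max_len_ge0].
have expE : expR (theta * longest) * expR (theta * (agew j w + A j w)) =
    expR (theta * (agew j w + A j w + longest)) by rewrite -expRD -mulrDr addrC.
rewrite -real_normK ?num_real// /excess_scale -[leRHS]mulrA expE -[leRHS]mulrA.
set b := agew j w + A j w + longest.
apply: (@le_trans _ _ (((1 + `|Delta| + `|cycle|) * (1 + b ^+ 2)) ^+ 2)).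
  rewrite ler_sqr ?nnegrE ?mulr_ge0 ?addr_ge0 ?sqr_ge0//.
  by apply: normr_excess_le => //; exact: residual_ge0.
by rewrite exprMn ler_wpM2l ?sqr_ge0//; exact: sqr_quad_le_expR.
Qed.

Let measurable_excessw j :
  measurable_fun [set: TP j * TI j] (fun x => excessw j x.1 x.2).
Proof.
have [mage mres] := measurable_past_age_residual (leqnn j).
apply: measurable_excess => //.
- exact: measurableT_comp mage measurable_fst.
- exact: measurableT_comp mres measurable_fst.
- by move=> f; exact: measurable_selection_innovation.
Qed.

Let measurable_past_excess i j : (i < j)%N ->
  measurable_fun [set: TP j] (fun w => excessw i w w).
Proof.
move=> ij; have [mage mres] := measurable_past_age_residual (ltnW ij).
apply: measurable_excess => //; first exact: measurable_past_arrival.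
move=> f; pose mark (x : 'I_n) b : R := f (if (x < k)%N || b then Some x else None).
exact: (@measurable_past_mark _ _ _ _ A X C _ _ _ _ mark ij).
Qed.

Lemma ae_cvg0_potential : {ae P, forall w,
  potential len Delta cycle k (A^~ w) (X^~ w) (C^~ w) N / N%:R @[N --> \oo] --> 0}.
Proof.
have : {ae P, forall w, (\sum_(0 <= j < N) excessw j w w) / N%:R @[N --> \oo] --> 0}.
  apply: (strong_law_innovations mA mX mC indep (K := excess_scale * moment_bound)) => //.
  - by move=> j w; apply: (integral_excess _ _ _).1; exact: residual_ge0.
  - by move=> j w; apply: (integral_excess _ _ _).2; exact: residual_ge0.
  - move=> j; apply: (integral_sqr_le_expR (j := j)) => //.
      exact: (measurable_past_T mA mX mC (measurable_past_excess (ltnSn j))).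
    by rewrite mulr_ge0 ?expR_ge0// mulr_ge0// sqr_ge0.
apply: filterS => w sum_cvg.
rewrite (_ : (fun N => _) = (fun N => (\sum_(0 <= j < N) excessw j w w) / N%:R))//.
by apply/funext => N; rewrite potential_sum.
Qed.

Lemma ae_cvg_prior_arrival : {ae P, forall w,
  prior_arrival (A^~ w) N / N%:R @[N --> \oo] --> lambda^-1}.
Proof.
have sub_quad y : y - lambda^-1 = - lambda^-1 + 1 * y + 0 * y ^+ 2 by ring.
have sqr_quad y : (y - lambda^-1) ^+ 2 = lambda^-1 ^+ 2 + (- 2 / lambda) * y + 1 * y ^+ 2.
  by ring.
have : {ae P, forall w, (\sum_(0 <= j < N) (A j w - lambda^-1)) / N%:R @[N --> \oo] --> 0}.
  apply: (strong_law_innovations mA mX mC indep (g := fun j w w' => A j w' - lambda^-1)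
    (K := lambda^-1 ^+ 2)).
  - by move=> j; exact: measurable_funB.
  - by move=> i j ij; apply: measurable_funB => //; exact: measurable_past_arrival.
  - by move=> j w; exact: (arrival_quadratic_mean j sub_quad).1.
  - move=> j w; rewrite (arrival_quadratic_mean j sub_quad).2.
    by congr EFin; ring.
  - move=> j; rewrite (arrival_quadratic_mean j sqr_quad).2 lee_fin le_eqVlt.
    by apply/orP; left; apply/eqP; field; rewrite gt_eqF.
apply: filterS => w mean0.
have : (\sum_(0 <= j < N) (A j w - lambda^-1)) / N%:R + lambda^-1 @[N --> \oo]
    --> 0 + lambda^-1 by apply: cvgD => //; exact: cvg_cst.
rewrite add0r; apply: cvg_trans; apply: near_eq_cvg; near=> N.
have N0 : N%:R != 0 :> R by rewrite pnatr_eq0 -lt0n; near: N; exact: nbhs_infty_gt.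
rewrite /prior_arrival sumrB sumr_const_nat subn0 -mulr_natr.
by field; rewrite N0 gt_eqF.
Unshelve. all: by end_near. Qed.

Lemma ae_cvg0_age : {ae P, forall w, agew N w / N%:R @[N --> \oo] --> 0}.
Proof.
have : {ae P, forall w, agew N.+1 w / N.+1%:R @[N --> \oo] --> 0}.
  apply: (ae_cvg0_div_index (K := growth * moment_bound)) => // N.
  exact: integral_sqr_age_le.
by apply: filterS => w; rewrite -(cvg_shiftS (fun N => agew N w / N%:R)).
Qed.

Lemma ae_avg_age_cvg : {ae P, forall w,
  avg_age k len (A^~ w) (X^~ w) (C^~ w) t @[t --> +oo] --> Delta%:E}.
Proof.
have potential_cvg := ae_cvg0_potential; have age_cvg := ae_cvg0_age.
have arrival_cvg := ae_cvg_prior_arrival; near=> w.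
have mean_arrival0 : 0 < lambda^-1 by rewrite invr_gt0.
by apply: (avg_age_cvg_of_potential (cycle := cycle) (A0^~ w) mean_arrival0); near: w.
Unshelve. all: by end_near. Qed.

End UpdateSystem.

Lemma mutually_independent_comp {d : measure_display} {T : measurableType d}
    {R : realType} (P : probability T R) (n : nat) (A : nat -> T -> R)
    (X : nat -> T -> 'I_n) (C : nat -> T -> bool) (f : R -> R) :
  measurable_fun setT f -> mutually_independent P A X C ->
  mutually_independent P (fun j w => f (A j w)) X C.
Proof.
move=> mf indep JA JX JC B S D uA uX uC mB.
apply: (indep _ _ _ (fun j => f @^-1` B j)) => // j.
by rewrite -[X in measurable X]setTI; exact: mf.
Qed.

Lemma ae_ge0_of_null_tail {d : measure_display} {T : measurableType d} {R : realType}
    (P : probability T R) (A : T -> R) :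
  measurable_fun setT A -> P [set w | A w <= 0] = 0%E -> {ae P, forall w, 0 <= A w}.
Proof.
move=> mA PA0; exists [set w | A w <= 0]; split => //.
  by rewrite -[X in measurable X]setTI; exact: measurable_fun_le.
by move=> w /= /negP; rewrite -ltNge => /ltW.
Qed.

Theorem theorem2 (R : realType) (d : measure_display) (T : measurableType d)
  (P : probability T R) (n k : nat) (p : 'I_n -> R) (len : 'I_n -> nat)
  (alpha lambda : R)
  (A : nat -> T -> R) (X : nat -> T -> 'I_n) (C : nat -> T -> bool) :
  (0 < k)%N -> (k <= n)%N ->
  0 < lambda -> 0 <= alpha <= 1 ->
  (forall i, 0 <= p i) -> \sum_(i < n) p i = 1 ->
  (forall i j : 'I_n, (i <= j)%N -> p j <= p i) ->
  (forall j, measurable_fun setT (A j)) ->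
  (forall j i, measurable [set w | X j w = i]) ->
  (forall j, measurable [set w | C j w]) ->
  (forall j s, 0 <= s ->
     P [set w | A j w <= s] = (1 - expR (- lambda * s))%:E) ->
  (forall j i, P [set w | X j w = i] = (p i)%:E) ->
  (forall j, P [set w | C j w] = alpha%:E) ->
  mutually_independent P A X C ->
  {ae P, forall w,
     avg_age k len (fun m => A m w) (fun m => X m w) (fun m => C m w) t
       @[t --> +oo] --> (Delta_alpha k p alpha lambda len)%:E}.
Proof.
move=> k0 kn lambda0 /andP[alpha0 alpha1] p0 p1 p_nincr mA mX mC A_cdf X_pmf C_prob indep.
pose Aplus j w := Num.max (A j w) 0.
have mmax : measurable_fun setT (fun x : R => Num.max x 0) by exact: measurable_maxr.
have mAplus j : measurable_fun setT (Aplus j) by exact: measurableT_comp mmax (mA j).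
have Aplus_ge0 j w : 0 <= Aplus j w by rewrite le_max lexx orbT.
have Aplus_cdf j s : 0 <= s ->
    P [set w | Aplus j w <= s] = (1 - expR (- lambda * s))%:E.
  by move=> s0; rewrite -(A_cdf j s s0); congr (P _); apply/seteqP; split=> w /=;
    rewrite ge_max s0 andbT.
have A_ge0 : {ae P, forall w j, 0 <= A j w}.
  apply: ae_foralln => j; apply: ae_ge0_of_null_tail => //.
  by rewrite A_cdf// mulr0 expR0 subrr.
have q0 := q_ka_gt0 k0 kn alpha0 p0 p1 p_nincr.
have q1 := q_ka_le1 k alpha1 p0 p1.
have Aplus_cvg := ae_avg_age_cvg len lambda0 alpha0 p0 q0 q1 mAplus mX mC
  Aplus_ge0 Aplus_cdf X_pmf C_prob (mutually_independent_comp mmax indep).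
apply: filterS2 A_ge0 Aplus_cvg => w Aw0.
by have -> : Aplus^~ w = A^~ w by apply/funext => j; rewrite /Aplus max_l.
Qed.
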